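(* Let $\{\Phi_1,\dots,\Phi_N\}$, $N\ge 2$, be contractive similarity mappings of $\mathbb{R}^d$ with scaling ratios $r_1,\dots,r_N\in(0,1)$, satisfying the open set condition, and suppose its self-similar set (attractor) is nontrivial. Let $O$ be a feasible open set and let $\mathcal{T}=\mathcal{T}(O)$ be the associated self-similar tiling. Suppose that $\mathcal{T}$ has a single generator $G$, that $G$ is monophase, with inradius $g$ and coefficients $\kappa_k(G)$, and that the abscissa of convergence $D$ of the associated scaling zeta function $\zeta_{\mathcal{L}}$ satisfies $d-1<D$. Put $$\Gamma_D(G):=\sum_{k=0}^{d-1}\frac{g^{D-k}}{D-k}\,(d-k)\,\kappa_k(G).$$ Then: (1) $\dim_M\mathcal{T}=D$. (2) $\mathcal{T}$ is Minkowski measurable if and only if $\zeta_{\mathcal{L}}$ is nonlattice. In this (nonlattice) case the Minkowski content of $\mathcal{T}$ is $$\mathcal{M}_D(\mathcal{T})=\frac{\Gamma_D(G)}{(d-D)\sum_{n=1}^N r_n^{D}\log r_n^{-1}},$$ and $0<\mathcal{M}_D(\mathcal{T})<\infty$. (3) In the lattice case, with $r_n=r^{k_n}$ for $n=1,\dots,N$, the ($D$-dimensional) Minkowski content of $\mathcal{T}$ does not exist, but the average Minkowski content $\overline{\mathcal{M}}_D(\mathcal{T})$ exists and $$\overline{\mathcal{M}}_D(\mathcal{T})=\frac{\Gamma_D(G)}{(d-D)\sum_{n=1}^N r^{k_nD}\,k_n\log r^{-1}},$$ and $0<\overline{\mathcal{M}}_D(\mathcal{T})<\infty$.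
   Context: **Self-similar sets and the open set condition.** For $A\subset\mathbb{R}^d$ write $\Phi(A):=\bigcup_{n=1}^N\Phi_n(A)$. The self-similar set (attractor) $F$ of the system is the unique nonempty compact set with $F=\Phi(F)$. The open set condition (OSC) holds if there is a nonempty open set $O\subset\mathbb{R}^d$ with $\Phi_n(O)\subset O$ for all $n$ and $\Phi_n(O)\cap\Phi_m(O)=\emptyset$ for $n\ne m$; any such $O$ is called a feasible open set. $F$ (satisfying OSC) is nontrivial if there exists a feasible open set $O$ with $O\not\subset\Phi(\overline{O})$. **Self-similar tiling.** Let $\mathcal{W}:=\bigcup_{k\ge0}\{1,\dots,N\}^k$ be the set of finite words. For $w=w_1\cdots w_n\in\mathcal{W}$ put $r_w:=r_{w_1}\cdots r_{w_n}$ and $\Phi_w:=\Phi_{w_1}\circ\cdots\circ\Phi_{w_n}$; for the empty word $r_w=1$ and $\Phi_w=\mathrm{Id}$. For a feasible open set $O$, the generators are the connected components $G_q$ ($q\in Q$, $Q$ finite) of the open set $O\setminus\Phi(\overline{O})$, and the self-similar tiling is $\mathcal{T}(O):=\{\Phi_w(G_q): w\in\mathcal{W}, q\in Q\}$. A single generator $G$ means that $O\setminus\Phi(\overline{O})=G$ is connected (and nonempty). Let $T:=\bigcup_{R\in\mathcal{T}}R$ be the union of the tiles. **Monophase.** For a bounded open set $G\subset\mathbb{R}^d$, let $g>0$ be its inradius (the maximal radius of a ball contained in $G$) and $V(G,\varepsilon):=\lambda_d(\{x\in G: d(x,G^c)\le\varepsilon\})$ for $\varepsilon\ge 0$, where $\lambda_d$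 is Lebesgue measure and $d(x,\cdot)$ is Euclidean distance to a set. $G$ is monophase if there are real constants $\kappa_0(G),\dots,\kappa_d(G)$ with $V(G,\varepsilon)=\sum_{k=0}^{d}\kappa_k(G)\,\varepsilon^{d-k}$ for all $0<\varepsilon\le g$. These constants are then unique, and $\kappa_d(G)=0$. **Scaling zeta function.** $\zeta_{\mathcal{L}}$ is the meromorphic extension to $\mathbb{C}$ of the Dirichlet series $\sum_{w\in\mathcal{W}}r_w^s$, i.e. $\zeta_{\mathcal{L}}(s)=\dfrac{1}{1-\sum_{n=1}^N r_n^s}$. Its abscissa of convergence $D$ is the real number such that the series converges if and only if $\operatorname{Re}s>D$; equivalently, $D$ is the unique real solution of $\sum_{n=1}^N r_n^s=1$. **Lattice/nonlattice.** $\zeta_{\mathcal{L}}$ (or the tiling) is lattice if there are $r\in(0,1)$ and positive integers $k_1,\dots,k_N$ with $r_n=r^{k_n}$ for all $n$; otherwise it is nonlattice. **Minkowski content of a tiling.** Let $V(T,\varepsilon):=\lambda_d(\{x\in T: d(x,T^c)\le\varepsilon\})$. For $0\le\alpha\le d$, the $\alpha$-dimensional Minkowski content is $\mathcal{M}_\alpha(\mathcal{T}):=\lim_{\varepsilon\to0^+}\varepsilon^{-(d-\alpha)}V(T,\varepsilon)$, whenever this limit exists in $[0,\infty]$. $\mathcal{T}$ is Minkowski measurable (of dimension $\alpha$) if $\mathcal{M}_\alpha(\mathcal{T})$ exists and $0<\mathcal{M}_\alpha(\mathcal{T})<\infty$; ''Minkowski measurable'' without further specification means of some dimension $\alpha\in[0,d]$.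 The Minkowski dimension is $\dim_M\mathcal{T}:=\inf\{\alpha\ge0:\mathcal{M}_\alpha(\mathcal{T})=0\}\in[0,d]$. The $\alpha$-dimensional average Minkowski content is $$\overline{\mathcal{M}}_\alpha(\mathcal{T}):=\lim_{b\to\infty}\frac1{\log b}\int_{1/b}^1\varepsilon^{-(d-\alpha)}V(T,\varepsilon)\,\frac{d\varepsilon}{\varepsilon},$$ whenever this limit exists in $[0,\infty]$. *)

(* Defs.v *)
From HB Require Import structures.
From mathcomp Require Import all_boot all_order all_algebra.
From mathcomp Require Import complex.
From mathcomp Require Import all_classical all_reals all_analysis.

Set Implicit Arguments.
Unset Strict Implicit.
Unset Printing Implicit Defensive.

Import Order.TTheory GRing.Theory Num.Theory.
Import numFieldNormedType.Exports.

Local Open Scope classical_set_scope.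
Local Open Scope ring_scope.

(* R^d is 'rV[R]_d. The topology of the library on 'rV[R]_d is the one of the
   sup norm, i.e. the usual one; the metric notions below are Euclidean. *)

Section Euclidean.
Context {R : realType} {d : nat}.
Implicit Types (x y : 'rV[R]_d) (A : set 'rV[R]_d).

Definition eucl_dist x y : R := Num.sqrt (\sum_(j < d) (x 0 j - y 0 j) ^+ 2).

Definition eucl_ball x (s : R) : set 'rV[R]_d := [set y | eucl_dist x y < s].

(* Only meaningful for A nonempty: inf set0 = 0 in the library. *)
Definition dist_to x A : R := inf [set eucl_dist x y | y in A].

Definition similarity (rho : R) (f : 'rV[R]_d -> 'rV[R]_d) : Prop :=
  forall x y, eucl_dist (f x) (f y) = rho * eucl_dist x y.

Definition box (a b : 'rV[R]_d) : set 'rV[R]_d :=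
  [set x | forall j, a 0 j <= x 0 j <= b 0 j].

(* Lebesgue outer measure on R^d (d >= 1; for d = 0 every box has volume 1, so
   that the infimum over infinite covers is not the right value). On Lebesgue
   measurable sets it is the Lebesgue measure. *)
Definition lebesgue_d A : \bar R :=
  ereal_inf [set (\sum_(0 <= i <oo)
                    (\prod_(j < d) (ab.2 i 0 j - ab.1 i 0 j))%:E)%E |
    ab in [set ab : (nat -> 'rV[R]_d) * (nat -> 'rV[R]_d) |
      (forall i j, ab.1 i 0 j <= ab.2 i 0 j) /\
      A `<=` \bigcup_i box (ab.1 i) (ab.2 i)]].

(* V(A, eps) *)
Definition inner_tube A (eps : R) : \bar R :=
  lebesgue_d [set x | A x /\ dist_to x (~` A) <= eps].

Definition is_inradius A (g : R) : Prop :=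
  [/\ 0 < g, exists x, eucl_ball x g `<=` A &
      forall x s, 0 < s -> eucl_ball x s `<=` A -> s <= g].

Definition monophase A (g : R) (kappa : 'I_d.+1 -> R) : Prop :=
  [/\ open A, bounded_set A, is_inradius A g &
      forall eps, 0 < eps <= g ->
        inner_tube A eps = (\sum_(k < d.+1) kappa k * eps ^+ (d - k))%:E].

Definition Gamma_coef (g : R) (kappa : 'I_d.+1 -> R) (D : R) : R :=
  \sum_(k < d.+1 | (k < d)%N)
    g `^ (D - k%:R) / (D - k%:R) * (d - k)%:R * kappa k.

End Euclidean.

Section IFS.
Context {R : realType} {d N : nat}.
Variable Phi : 'I_N -> 'rV[R]_d -> 'rV[R]_d.
Implicit Types (A F O G : set 'rV[R]_d).

Definition ifs_image A : set 'rV[R]_d := \bigcup_(n in [set: 'I_N]) (Phi n @` A).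

Definition is_attractor F : Prop :=
  [/\ F !=set0, compact F & F = ifs_image F].

Definition feasible O : Prop :=
  [/\ open O, O !=set0, forall n, Phi n @` O `<=` O &
      forall n m, n != m -> (Phi n @` O) `&` (Phi m @` O) = set0].

Definition open_set_condition : Prop := exists O, feasible O.

Definition nontrivial_attractor F : Prop :=
  is_attractor F /\ exists O, feasible O /\ ~ O `<=` ifs_image (closure O).

Definition word_map (w : seq 'I_N) : 'rV[R]_d -> 'rV[R]_d :=
  foldr (fun n f => Phi n \o f) idfun w.

Definition gap O : set 'rV[R]_d := O `\` ifs_image (closure O).

Definition generators O : set (set 'rV[R]_d) :=
  [set connected_component (gap O) x | x in gap O].

Definition tiling O : set (set 'rV[R]_d) :=
  [set A | exists w G, generators O G /\ A = word_map w @` G].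

Definition single_generator O G : Prop :=
  [/\ gap O = G, connected G & G !=set0].

End IFS.

Section Zeta.
Context {R : realType} {N : nat}.
Variable r : 'I_N -> R.

Definition word_ratio (w : seq 'I_N) : R := \prod_(n <- w) r n.

(* x ^ s = exp (s log x) for x > 0 and s complex *)
Definition cpow (x : R) (s : R[i]) : R[i] :=
  Complex (expR (complex.Re s * ln x) * cos (complex.Im s * ln x))
          (expR (complex.Re s * ln x) * sin (complex.Im s * ln x)).

(* The index set of words carries no order, so convergence is summability of
   the family, i.e. absolute convergence. *)
Definition scaling_series_converges (s : R[i]) : Prop :=
  (\esum_(w in [set: seq 'I_N])
     (Normc.normc (cpow (word_ratio w) s))%:E < +oo)%E.

Definition abscissa_of_convergence (D : R) : Prop :=
  forall s : R[i], scaling_series_converges s <-> D < complex.Re s.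

Definition lattice_with (rho : R) (k : 'I_N -> nat) : Prop :=
  0 < rho < 1 /\ forall n, (0 < k n)%N /\ r n = rho ^+ k n.

Definition lattice : Prop := exists rho k, lattice_with rho k.

End Zeta.

Section Minkowski.
Context {R : realType} {d : nat}.
Implicit Types (TT : set (set 'rV[R]_d)) (alpha : R) (M : \bar R).

Definition tiling_tube TT (eps : R) : \bar R :=
  inner_tube (\bigcup_(A in TT) A) eps.

(* "the content exists and equals M"; M ranges over [0, +oo] as the tube
   volumes are nonnegative *)
Definition minkowski_content TT alpha M : Prop :=
  ((eps `^ (- (d%:R - alpha)))%:E * tiling_tube TT eps)%E
    @[eps --> (0 : R)^'+] --> M.

Definition minkowski_measurable_of_dim TT alpha : Prop :=
  exists M, minkowski_content TT alpha M /\ (0 < M < +oo)%E.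

Definition minkowski_measurable TT : Prop :=
  exists alpha, 0 <= alpha <= d%:R /\ minkowski_measurable_of_dim TT alpha.

Definition minkowski_dim TT : R :=
  inf [set alpha | 0 <= alpha <= d%:R /\ minkowski_content TT alpha 0%E].

Definition average_minkowski_content TT alpha M : Prop :=
  (((ln b)^-1)%R%:E *
   \int[lebesgue_measure]_(eps in `[b^-1%R, 1%R])
     ((eps `^ (- (d%:R - alpha)))%:E * tiling_tube TT eps * (eps^-1)%R%:E))%E
    @[b --> (+oo)%R] --> M.

End Minkowski.

(* Main.v *)
Require Import Defs.
From HB Require Import structures.
From mathcomp Require Import all_boot all_order all_algebra.
From mathcomp Require Import complex fingroup perm.
From mathcomp Require Import all_classical all_reals all_analysis.
From mathcomp Require Import measurable_realfun.
From mathcomp Require Import ring lra.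

Set Implicit Arguments.
Unset Strict Implicit.
Unset Printing Implicit Defensive.

Import Order.TTheory GRing.Theory Num.Theory.
Import numFieldNormedType.Exports.

Local Open Scope classical_set_scope.
Local Open Scope ring_scope.

(** In logarithmic scale the tube volume of the tiling satisfies a renewal
    equation, and the three assertions are three facts about its solutions.

    Write [T] for the union of the tiles, [u e] for the volume of its inner
    [e]-tube and [f e] for that of the generator [G]. The open sets [G] and
    [Phi n @` T] are disjoint with union [T]. A segment that leaves such a piece
    leaves [T] on the way, so that the distance from a point of the piece to the
    complement of [T] is its distance to the complement of the piece. With the
    scaling of Lebesgue measure under similarities ([lebesgue_similarity]) this
    gives the tube equation ([inner_tube_tiles])
      [u e = f e + \sum_n r n ^+ d * u (e / r n)].
    Put [theta = d - D] and [h t = expR (theta * t) * u (expR (- t))]. Since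
    [\sum_n r n `^ D = 1] ([abscissa_moran]), the equation becomes
      [h t = z t + \sum_n p n * h (t - a n)]
    with weights [p n = r n `^ D] of total mass one and steps [a n = - ln (r n)].
    The source [z] decays exponentially at both ends, at [+oo] because
    [d - 1 < D]; here the polynomial form of [f] enters. The Minkowski content of
    dimension [D] is the limit of [h] at [+oo].

    Let [H] be a primitive of [h]. The derivative of
    [H t - \sum_n p n * H (t - a n)] is [z], so that this quantity converges, and
    its limit is [Gamma_coef g kappa D / theta]. It is also the sum of the
    integrals of [h] over the windows from [t - a n] to [t], weighted by [p n];
    hence the only possible limit of [h] is that number divided by
    [mu = \sum_n p n * a n], and [h] is bounded, as [u] is monotone.

    Nonlattice case. Where [h] is close to its upper limit, so is it at the points
    [t - a n], whose values it averages, and by iteration at all points [t - s]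
    with [s] a sum of steps. These sums are dense far out ([nonlattice_dense]), so
    that [h] is close to its upper limit on long windows
    ([close_to_upper_limit_on_window]), and likewise for the lower limit.
    Comparison with the conserved quantity shows that both limits have the value
    above ([renewal_dense_cvg]).

    Lattice case. If all steps are multiples of [l], sums of [h] along a
    progression of step [l] obey a discrete conservation law. If [h] converged,
    the conserved value would not depend on the starting point [tau] of the
    progression. But on an interval it is a combination of exponentials of [tau]
    in which [expR (theta * tau)] has a positive coefficient, and so it is not
    constant ([log_tube_not_cvg_lattice]).

    The average content is the limit of [H t / t], and it exists in both cases:
    the difference between [H] and its expected linear growth increases far out by
    less than any given amount per step ([renewal_average]). The dimension is [D]
    because [h] is bounded and does not tend to zero. *)

(** * Semigroup of sums of steps *)

Section StepSums.
Context {R : realType} {N : nat}.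
Variable a : 'I_N -> R.
Hypothesis a_gt0 : forall n, 0 < a n.
Implicit Types w : seq 'I_N.

Definition step_sum w : R := \sum_(n <- w) a n.

Lemma step_sum_nil : step_sum [::] = 0.
Proof. by rewrite /step_sum big_nil. Qed.

Lemma step_sum_cons n w : step_sum (n :: w) = a n + step_sum w.
Proof. by rewrite /step_sum big_cons. Qed.

Lemma step_sum_cat w w' : step_sum (w ++ w') = step_sum w + step_sum w'.
Proof. by rewrite /step_sum big_cat. Qed.

Lemma step_sum_repeat k w : step_sum (flatten (nseq k w)) = k%:R * step_sum w.
Proof.
elim: k => [|k IH] /=; first by rewrite step_sum_nil mul0r.
by rewrite step_sum_cat IH -natr1; ring.
Qed.

Lemma steps_have_minimum : exists2 m : R, 0 < m & forall n, m <= a n.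
Proof.
suff [m m0 Hm] : exists2 m : R, 0 < m & forall n, n \in enum 'I_N -> m <= a n.
  by exists m => // n; apply: Hm; rewrite mem_enum.
elim: (enum 'I_N) => [|n s [m m0 IH]]; first by exists 1.
exists (Num.min m (a n)); first by rewrite lt_min m0 a_gt0.
move=> k; rewrite inE => /orP[/eqP ->|/IH]; first by rewrite ge_min lexx orbT.
by move=> mk; rewrite ge_min mk.
Qed.

Lemma steps_have_maximum : exists2 m : R, 0 < m & forall n, a n <= m.
Proof.
exists (1 + \sum_n a n).
  by apply: ltr_pwDl => //; apply: sumr_ge0 => n _; apply: ltW.
move=> n; rewrite (bigD1 n) //=.
have : 0 <= \sum_(i < N | i != n) a i by apply: sumr_ge0 => i _; apply: ltW.
by lra.
Qed.

Lemma step_sum_ge m w : (forall n, m <= a n) -> m * (size w)%:R <= step_sum w.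
Proof.
move=> ma; elim: w => [|n w IH]; first by rewrite step_sum_nil mulr0.
by rewrite step_sum_cons /= -natr1; have := ma n; lra.
Qed.

Definition step_difference x :=
  exists w w', x = step_sum w - step_sum w'.

Lemma step_differenceB x y :
  step_difference x -> step_difference y -> step_difference (x - y).
Proof.
move=> [w [w' ->]] [v [v' ->]]; exists (w ++ v'), (w' ++ v).
by rewrite !step_sum_cat; ring.
Qed.

Lemma step_difference_step n : step_difference (a n).
Proof.
by exists [:: n], [::]; rewrite step_sum_cons !step_sum_nil; ring.
Qed.

(** A small positive difference [e = s - s'] of step sums makes the semigroup
    [e]-dense far out: [j * s + (i - j) * s'] advances by [e] with [j], and as
    soon as [i * e >= s'] these progressions overlap for consecutive [i]. *)
Lemma small_difference_dense e x y : (0 < N)%N ->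
  step_difference e -> 0 < e -> e <= y - x ->
  exists X, forall t, X <= t -> exists w, x <= t - step_sum w <= y.
Proof.
move=> N0 [w0 [w0' De]] e0 exy.
pose n0 : 'I_N := Ordinal N0.
pose w := n0 :: w0; pose w' := n0 :: w0'.
have {}De : e = step_sum w - step_sum w' by rewrite De !step_sum_cons; ring.
pose c := step_sum w'.
have c0 : 0 < c.
  rewrite /c step_sum_cons; have [m m0 ma] := steps_have_minimum.
  have := step_sum_ge w0' ma; have := ma n0.
  have : 0 <= m * (size w0')%:R by rewrite mulr_ge0 // ltW.
  by lra.
pose K := (Num.truncn (c / e)).+1.
have Kc : c < K%:R * e by rewrite -ltr_pdivrMr // truncnS_gt.
exists (K%:R * c + x) => t Xt.
pose i := Num.truncn ((t - x) / c).
have tx0 : 0 <= t - x.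
  have : 0 <= K%:R * c by rewrite mulr_ge0 // ltW.
  by lra.
have /andP[i1 i2] : i%:R <= (t - x) / c < i.+1%:R.
  by apply: truncn_itv; rewrite divr_ge0 // ltW.
rewrite ler_pdivlMr // in i1; rewrite ltr_pdivrMr // in i2.
have Ki : (K <= i)%N.
  rewrite -ltnS -(ltr_nat R); rewrite -(ltr_pM2r c0).
  by apply: le_lt_trans i2; lra.
pose q := t - x - i%:R * c.
have q0 : 0 <= q by rewrite /q; lra.
have qc : q < c by rewrite /q; move: i2; rewrite -natr1; lra.
pose j := Num.truncn (q / e).
have /andP[j1 j2] : j%:R <= q / e < j.+1%:R.
  by apply: truncn_itv; rewrite divr_ge0 // ltW.
rewrite ler_pdivlMr // in j1; rewrite ltr_pdivrMr // in j2.
have ji : (j <= i)%N.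
  apply: leq_trans Ki; rewrite -(ler_nat R) -(ler_pM2r e0).
  by apply: ltW; apply: le_lt_trans Kc; lra.
exists (flatten (nseq j w) ++ flatten (nseq (i - j) w')).
rewrite step_sum_cat !step_sum_repeat natrB //.
have -> : j%:R * step_sum w + (i%:R - j%:R) * step_sum w' = i%:R * c + j%:R * e.
  by rewrite De /c; ring.
move: j2; rewrite -natr1 /q in j1 *; move=> j2.
by apply/andP; split; lra.
Qed.

Lemma step_differenceMn x y k : step_difference x -> step_difference y ->
  step_difference (y - k%:R * x).
Proof.
move=> Dx; elim: k y => [|k IH] y Dy; first by rewrite mul0r subr0.
have -> : y - k.+1%:R * x = (y - x) - k%:R * x by rewrite -natr1; ring.
by apply/IH/step_differenceB.
Qed.

(** A subgroup of the line without small positive elements is generated by its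
    least positive element, by Euclidean division. *)
Lemma no_small_difference_lattice e : (0 < N)%N -> 0 < e ->
  (forall x, step_difference x -> 0 < x -> e < x) ->
  exists2 l : R, 0 < l &
    exists k : 'I_N -> nat, forall n, (0 < k n)%N /\ a n = (k n)%:R * l.
Proof.
move=> N0 e0 small.
pose P := [set x | step_difference x /\ 0 < x].
have P0 : P !=set0.
  by exists (a (Ordinal N0)); split; [exact: step_difference_step|].
have Pe : lbound P e by move=> x [Dx x0]; apply/ltW/small.
have hP : has_inf P by split => //; exists e.
pose l := inf P.
have el : e <= l by apply: lb_le_inf.
have l0 : 0 < l by apply: lt_le_trans el.
have lP x : P x -> l <= x by move=> Px; apply: inf_lbound => //; exists e.
have [x [Dx x0] xl] : exists2 x, P x & x < l + e by apply: inf_adherent.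
have Ex : x = l.
  apply/eqP; rewrite eq_le lP // andbT leNgt; apply/negP => lx.
  have [y [Dy y0] yx] : exists2 y, P y & y < l + (x - l).
    by apply: inf_adherent => //; rewrite subr_gt0.
  have := small _ (step_differenceB Dx Dy); have := lP y (conj Dy y0).
  by move=> ly /(_ _); lra.
exists l => //; exists (fun n => Num.truncn (a n / l)) => n.
have /andP[k1 k2] : (Num.truncn (a n / l))%:R <= a n / l
    < (Num.truncn (a n / l)).+1%:R.
  by apply: truncn_itv; rewrite divr_ge0 // ltW.
set k := Num.truncn _ in k1 k2 *.
rewrite ler_pdivlMr // in k1; rewrite ltr_pdivrMr // -natr1 in k2.
have Ea : a n = k%:R * l.
  apply/eqP; rewrite eq_le k1 andbT leNgt; apply/negP => ka.
  have : P (a n - k%:R * l).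
    split; last by lra.
    by rewrite -Ex; apply: step_differenceMn => //; exact: step_difference_step.
  by move=> /lP; lra.
split => //; rewrite lt0n; apply/negP => /eqP k0.
by have := a_gt0 n; rewrite Ea k0 mul0r ltxx.
Qed.

Lemma nonlattice_dense x y : (0 < N)%N -> x < y ->
  ~ (exists2 l : R, 0 < l &
     exists k : 'I_N -> nat, forall n, (0 < k n)%N /\ a n = (k n)%:R * l) ->
  exists X, forall t, X <= t -> exists w, x <= t - step_sum w <= y.
Proof.
move=> N0 xy nl.
have [[e [De e0 exy]]|ne] :=
    pselect (exists e, [/\ step_difference e, 0 < e & e <= y - x]).
  exact: (small_difference_dense N0 De).
exfalso; apply/nl/(@no_small_difference_lattice (y - x)) => //.
  by rewrite subr_gt0.
move=> e De e0; rewrite ltNge; apply/negP => exy.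
by apply: ne; exists e; split.
Qed.

End StepSums.

(** * The renewal equation *)

Lemma cvg_pinftyP {R : realType} (f : R -> R) (l : R) :
  f t @[t --> +oo] --> l <->
  forall e : R, 0 < e -> exists T, forall t, T <= t -> `|f t - l| <= e.
Proof.
split=> [/cvgrPdist_le fl e e0|fl].
  have [T [_ HT]] := fl e e0.
  by exists (T + 1) => t Tt; rewrite distrC; apply: HT; lra.
apply/cvgrPdist_le => e e0; have [T HT] := fl e e0.
by exists T; split; [exact: num_real|move=> t /ltW Tt; rewrite distrC; exact: HT].
Qed.

(** The limit superior of an eventually bounded function, as the two properties
    by which the arguments below use it. *)
Lemma upper_limit_exists {R : realType} (f : R -> R) (T0 b B : R) :
  (forall t, T0 <= t -> b <= f t <= B) ->
  exists M, (forall e : R, 0 < e -> exists T, forall t, T <= t -> f t <= M + e) /\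
    (forall e T : R, 0 < e -> exists2 t : R, T <= t & M - e <= f t).
Proof.
move=> fB.
pose E := [set c | exists T, forall t, T <= t -> f t <= c].
have E0 : E !=set0 by exists B, T0 => t /fB /andP[].
have lE : lbound E b.
  move=> c [T HT]; have := HT (Num.max T T0); rewrite le_max lexx => /(_ isT).
  apply: le_trans; have := fB (Num.max T T0).
  by rewrite le_max lexx orbT => /(_ isT) /andP[].
exists (inf E); split.
  move=> e e0; have [|c [T HT] ce] := @inf_adherent _ E e e0.
    by split => //; exists b.
  by exists T => t /HT; lra.
move=> e T e0; apply: contrapT => ne.
suff : E (inf E - e).
  by move=> /(ge_inf (ex_intro _ b lE)); lra.
exists T => t Tt; rewrite leNgt; apply/negP => /ltW ft.
by apply: ne; exists t.
Qed.

Lemma MVT_bounds {R : realType} (H h : R -> R) (m M x y : R) : x <= y ->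
  (forall t : R, is_derive t 1 H (h t)) ->
  (forall t, x <= t <= y -> m <= h t <= M) ->
  m * (y - x) <= H y - H x <= M * (y - x).
Proof.
move=> xy dH hmM; have [c cxy ->] := MVT_segment xy (fun t _ => dH t)
  (derivable_within_continuous (fun t _ => @ex_derive _ _ _ _ _ _ _ (dH t))).
have /andP[mh hM] := hmM c cxy.
by rewrite !ler_wpM2r // subr_ge0.
Qed.

Section UpperLimitSpreads.
Context {R : realType} {N : nat}.
Variables (p a : 'I_N -> R) (f z : R -> R) (M : R).
Hypothesis p_gt0 : forall n, 0 < p n.
Hypothesis p_sum1 : \sum_n p n = 1.
Hypothesis a_gt0 : forall n, 0 < a n.
Hypothesis f_renewal : forall t, f t = z t + \sum_n p n * f (t - a n).
Hypothesis z_cvg0 : z t @[t --> +oo] --> (0 : R).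
Hypothesis f_le : forall e : R, 0 < e -> exists T, forall t, T <= t -> f t <= M + e.
Hypothesis f_close : forall e T : R, 0 < e -> exists2 t : R, T <= t & M - e <= f t.

(** An average of values that are at most about [M] can be close to [M] only if
    each of the values is; so closeness to [M] at [t] passes to all [t - a n],
    and by iteration to [t - s] for every step sum [s] of bounded length. *)
Lemma close_to_upper_limit_spreads m e : 0 < e ->
  exists2 e' : R, 0 < e' & exists T, forall t, T <= t -> M - e' <= f t ->
    forall w, (size w <= m)%N -> M - e <= f (t - step_sum a w).
Proof.
move=> e0; elim: m e e0 => [|m IH] e e0.
  exists e => //; exists 0 => t _ ft [|//] _.
  by rewrite step_sum_nil subr0.
have [e1 e10 [T1 HT1]] := IH e e0.
have [q q0 qp] := steps_have_minimum p_gt0.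
have [b b0 ab] := steps_have_maximum a_gt0.
pose e2 := Num.min e (e1 * q / 3).
have e20 : 0 < e2 by rewrite lt_min e0 /= divr_gt0 // mulr_gt0.
have e2e : e2 <= e by rewrite ge_min lexx.
have e2q : 3 * e2 <= e1 * q.
  have : e2 <= e1 * q / 3 by rewrite ge_min lexx orbT.
  by lra.
have [T2 HT2] := f_le e20.
have [T3 HT3] := (cvg_pinftyP _ _).1 z_cvg0 e2 e20.
exists e2 => //; exists (Num.max T1 (Num.max T2 T3) + b) => t.
have [m1 [m2 m3]] : T1 <= Num.max T1 (Num.max T2 T3) /\
    T2 <= Num.max T1 (Num.max T2 T3) /\ T3 <= Num.max T1 (Num.max T2 T3).
  by rewrite !le_max !lexx !orbT.
move=> Tt ft [_|n w /= wm]; first by rewrite step_sum_nil subr0; lra.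
rewrite step_sum_cons opprD addrA; apply: HT1 => //; first by have := ab n; lra.
have fn : f t = z t + p n * f (t - a n) + \sum_(k < N | k != n) p k * f (t - a k).
  by rewrite f_renewal (bigD1 n) //= addrA.
have rest : \sum_(k < N | k != n) p k * f (t - a k) <= (1 - p n) * (M + e2).
  have -> : 1 - p n = \sum_(k < N | k != n) p k.
    by rewrite -p_sum1 (bigD1 n) //=; ring.
  rewrite mulr_suml; apply: ler_sum => k _; apply: (ler_wpM2l (ltW (p_gt0 k))).
  by apply: HT2; have := ab k; lra.
have zt : z t <= e2.
  have := HT3 t; rewrite subr0 => /(_ _) zt.
  by apply: le_trans (ler_norm _) _; apply: zt; lra.
rewrite -(ler_pM2l (p_gt0 n)).
have : e1 * q <= e1 * p n by rewrite ler_wpM2l // ltW.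
have : 0 <= p n * e2 by rewrite mulr_ge0 // ltW.
by move: ft; rewrite fn; have := p_gt0 n; lra.
Qed.

(** If the step sums are dense at infinity, every point of a window far behind a
    point [t] where [f t] is close to [M] is nearly of the form [t - s]; a slow
    variation of [f] then makes [f] close to [M] on the whole window. *)
Lemma close_to_upper_limit_on_window (T0 : R) :
  (forall e : R, 0 < e -> exists x y, x < y /\
     forall t, T0 <= t -> forall s, x <= s <= y -> f (t + s) - e <= f t) ->
  (forall x y, x < y ->
     exists X, forall t, X <= t -> exists w, x <= t - step_sum a w <= y) ->
  forall L e T, 0 < e -> exists2 t : R, T <= t &
    forall y, t - L <= y <= t -> M - e <= f y.
Proof.
move=> slow dense L e T e0; have e20 : 0 < e / 2 by rewrite divr_gt0.
have [x [y [xy Hs]]] := slow _ e20; have [X HX] := dense x y xy.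
have [b b0 ba] := steps_have_minimum a_gt0.
pose m := (Num.truncn ((X + L - x) / b)).+1.
have [e' e'0 [T' HT']] := close_to_upper_limit_spreads m e20.
pose S := `|T'| + `|T0| + `|T| + `|X| + `|L|.
have [t St ft] := f_close S e'0.
have [S1 S2 S3 S4] : [/\ T' <= S, T0 + X + L <= S, T + X <= S & 0 <= S].
  have := ler_norm T'; have := ler_norm T0; have := ler_norm T.
  have := ler_norm X; have := ler_norm L.
  have := normr_ge0 T'; have := normr_ge0 T0; have := normr_ge0 T.
  have := normr_ge0 X; have := normr_ge0 L.
  by rewrite /S; split; lra.
exists (t - X); first by lra.
move=> s /andP[s1 s2]; have [|w /andP[w1 w2]] := HX (t - s); first by lra.
have szw : (size w <= m)%N.
  rewrite /m -(ler_nat R); apply: ltW.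
  apply: le_lt_trans (truncnS_gt _); rewrite ler_pdivlMr //.
  by have := step_sum_ge w ba; lra.
have := HT' t _ ft w szw => /(_ _) H1.
have := Hs s _ (t - s - step_sum a w) => /(_ _ _) H2.
have : f (s + (t - s - step_sum a w)) - e / 2 <= f s.
  by apply: H2; [lra|apply/andP; split; lra].
have -> : s + (t - s - step_sum a w) = t - step_sum a w by ring.
have : M - e / 2 <= f (t - step_sum a w) by apply: H1; lra.
by lra.
Qed.

End UpperLimitSpreads.

Section Renewal.
Context {R : realType} {N : nat}.
Variables (p a : 'I_N -> R) (theta A : R) (h z H : R -> R).
Hypothesis N_gt0 : (0 < N)%N.
Hypothesis p_gt0 : forall n, 0 < p n.
Hypothesis p_sum1 : \sum_n p n = 1.
Hypothesis a_gt0 : forall n, 0 < a n.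
Hypothesis theta_ge0 : 0 <= theta.
Hypothesis h_ge0 : forall t, 0 <= h t.
Hypothesis h_growth : forall t s, 0 <= s -> h (t + s) <= expR (theta * s) * h t.
Hypothesis h_renewal : forall t, h t = z t + \sum_n p n * h (t - a n).
Hypothesis z_cvg0 : z t @[t --> +oo] --> (0 : R).
Hypothesis H_derive : forall t : R, is_derive t 1 H (h t).
(* The conservation law of the equation: this difference is the weighted sum of
   the integrals of [h] over the windows [t - a n, t]. *)
Hypothesis H_balance : H t - \sum_n p n * H (t - a n) @[t --> +oo] --> A.

Let mu := \sum_n p n * a n.

Lemma mean_step_gt0 : 0 < mu.
Proof.
rewrite /mu (bigD1 (Ordinal N_gt0)) //=; apply: ltr_pwDl; first exact: mulr_gt0.
by apply: sumr_ge0 => n _; rewrite ltW // mulr_gt0.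
Qed.

Lemma balanceE t : H t - \sum_n p n * H (t - a n) =
  \sum_n p n * (H t - H (t - a n)).
Proof.
under [RHS]eq_bigr do rewrite mulrBr.
by rewrite sumrB -mulr_suml p_sum1 mul1r.
Qed.

Lemma window_lower_bound t L m : (forall n, a n <= L) ->
  (forall y, t - L <= y <= t -> m <= h y) ->
  m * mu <= H t - \sum_n p n * H (t - a n).
Proof.
move=> aL hm; rewrite balanceE /mu mulr_sumr; apply: ler_sum => n _.
rewrite mulrCA; apply: (ler_wpM2l (ltW (p_gt0 n))).
pose Mx := expR (theta * a n) * h (t - a n).
have /andP[+ _] : m * (t - (t - a n)) <= H t - H (t - a n) <= Mx * (t - (t - a n)).
  apply: MVT_bounds => //; first by have := a_gt0 n; lra.
  move=> s /andP[s1 s2]; rewrite hm /=; last by have := aL n; lra.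
  have -> : s = (t - a n) + (s - (t - a n)) by ring.
  apply: le_trans (h_growth _ _) _; first by lra.
  by rewrite /Mx ler_wpM2r // ler_expR ler_wpM2l //; lra.
by rewrite opprB [t + _]addrC subrK.
Qed.

Lemma window_upper_bound t L m : (forall n, a n <= L) ->
  (forall y, t - L <= y <= t -> h y <= m) ->
  H t - \sum_n p n * H (t - a n) <= m * mu.
Proof.
move=> aL hm; rewrite balanceE /mu mulr_sumr; apply: ler_sum => n _.
rewrite [in leRHS]mulrCA; apply: (ler_wpM2l (ltW (p_gt0 n))).
have /andP[_ +] : 0 * (t - (t - a n)) <= H t - H (t - a n) <= m * (t - (t - a n)).
  apply: MVT_bounds => //; first by have := a_gt0 n; lra.
  by move=> s /andP[s1 s2]; rewrite h_ge0 hm //=; have := aL n; lra.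
by rewrite subKr.
Qed.

(** Since [h] cannot drop abruptly to the left, a large value [h t] makes the
    window integrals at [t] large; these are bounded by the conservation law. *)
Lemma renewal_bounded T0 : exists B, forall t, T0 <= t -> h t <= B.
Proof.
have [L L0 aL] := steps_have_maximum a_gt0.
have [T1 HT1] := (cvg_pinftyP _ _).1 H_balance 1 ltr01.
pose c := expR (theta * L) / mu.
have c0 : 0 < c by rewrite divr_gt0 ?expR_gt0 ?mean_step_gt0.
have big t : T1 <= t -> h t <= (A + 1) * c.
  move=> /HT1; set E := H t - _ => ET.
  have : expR (- (theta * L)) * h t * mu <= E.
    apply: (window_lower_bound aL) => y /andP[y1 y2].
    rewrite -(ler_pM2l (expR_gt0 (theta * L))) mulrA -expRD subrr expR0 mul1r.
    have -> : t = y + (t - y) by ring.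
    apply: le_trans (h_growth _ _) _; first by lra.
    by rewrite ler_wpM2r // ler_expR ler_wpM2l //; lra.
  move=> hE; have : E <= A + 1 by move: ET; rewrite ler_norml => /andP[]; lra.
  move=> EA; have {hE} := le_trans hE EA.
  rewrite expRN -ler_pdivlMr ?mean_step_gt0 // => hE.
  rewrite -(ler_pM2l (expR_gt0 (theta * L))) mulrA mulfV ?mul1r ?gt_eqF ?expR_gt0 // in hE.
  by move: hE; rewrite /c; congr (_ <= _); ring.
exists (Num.max ((A + 1) * c) (expR (theta * (T1 - T0)) * h T0)) => t Tt.
rewrite le_max; have [/big -> //|tT1] := leP T1 t.
have -> : t = T0 + (t - T0) by ring.
apply/orP; right; apply: le_trans (h_growth _ _) _; first by lra.
by rewrite ler_wpM2r // ler_expR ler_wpM2l //; lra.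
Qed.

Lemma h_slow_variation e T0 : 0 < e -> exists2 d, 0 < d &
  forall t s, T0 <= t -> 0 <= s <= d -> h (t + s) <= h t + e.
Proof.
have t1 : 0 < theta + 1 by rewrite ltr_wpDl.
move=> e0; have [B0 HB0] := renewal_bounded T0.
pose B := `|B0| + 1.
have B1 : 0 < B by rewrite ltr_wpDl.
have HB t : T0 <= t -> h t <= B.
  by move=> /HB0; rewrite /B; have := ler_norm B0; lra.
pose d := ln (1 + e / B) / (theta + 1).
have eB : 0 < e / B by rewrite divr_gt0.
have d0 : 0 < d by rewrite /d divr_gt0 // ln_gt0 //; lra.
exists d => // t s Tt /andP[s0 sd].
apply: le_trans (h_growth _ s0) _.
have ex : expR (theta * s) <= 1 + e / B.
  rewrite -[leRHS]lnK; last by rewrite posrE; lra.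
  rewrite ler_expR; have : theta * s <= (theta + 1) * d.
    by apply: ler_pM => //; lra.
  by move=> /le_trans; apply; rewrite /d mulrC divfK // gt_eqF.
have : expR (theta * s) * h t <= (1 + e / B) * h t by rewrite ler_wpM2r.
have : e / B * h t <= e / B * B by apply: (ler_wpM2l (ltW eB)); exact: HB.
rewrite divfK ?gt_eqF //; lra.
Qed.

(** The function comes close to its upper limit on whole windows, and close to
    its lower limit on others. The conserved quantity is about [mu] times either
    limit there, so that the two limits agree. *)
Lemma renewal_dense_cvg :
  (forall x y, x < y ->
     exists X, forall t, X <= t -> exists w, x <= t - step_sum a w <= y) ->
  h t @[t --> +oo] --> A / mu.
Proof.
move=> dense.
have [B HB] := renewal_bounded 0.
have [L L0 aL] := steps_have_maximum a_gt0.
have mu0 := mean_step_gt0.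
have [M [M1 M2]] : exists M,
    (forall e : R, 0 < e -> exists T, forall t, T <= t -> h t <= M + e) /\
    (forall e T : R, 0 < e -> exists2 t : R, T <= t & M - e <= h t).
  by apply: (@upper_limit_exists _ h 0 0 B) => t t0; rewrite h_ge0 HB.
have [m [m1 m2]] : exists m,
    (forall e : R, 0 < e -> exists T, forall t, T <= t -> - h t <= m + e) /\
    (forall e T : R, 0 < e -> exists2 t : R, T <= t & m - e <= - h t).
  apply: (@upper_limit_exists _ (fun t => - h t) 0 (- B) 0) => t t0.
  by rewrite oppr_le0 h_ge0 lerN2 HB.
have winM : forall L e T, 0 < e -> exists2 t : R, T <= t &
    forall y, t - L <= y <= t -> M - e <= h y.
  apply: (close_to_upper_limit_on_window p_gt0 p_sum1 a_gt0 h_renewal z_cvg0 M1 M2 (T0 := 0)) => //.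
  move=> e e0; have [d d0 Hd] := h_slow_variation 0 e0.
  exists 0, d; split=> // t t0 s sd.
  by have := Hd t s t0 sd; lra.
have winm : forall L e T, 0 < e -> exists2 t : R, T <= t &
    forall y, t - L <= y <= t -> m - e <= - h y.
  have hN t : - h t = - z t + \sum_n p n * - h (t - a n).
    rewrite h_renewal opprD; congr (_ + _); rewrite -sumrN.
    by apply: eq_bigr => n _; rewrite mulrN.
  have zN : - z t @[t --> +oo] --> (0 : R).
    by rewrite -[X in _ --> X]oppr0; apply: cvgN.
  apply: (close_to_upper_limit_on_window p_gt0 p_sum1 a_gt0 hN zN m1 m2 (T0 := 1)) => //.
  move=> e e0; have [d d0 Hd] := h_slow_variation 0 e0.
  pose d' := Num.min d 1.
  have d'0 : 0 < d' by rewrite lt_min d0 ltr01.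
  have [d'1 d'd] : d' <= 1 /\ d' <= d by rewrite !ge_min !lexx orbT.
  exists (- d'), 0; split; first by lra.
  move=> t t0 s /andP[s1 s2].
  have := Hd (t + s) (- s) => /(_ _ _) Hd'.
  have : h (t + s - s) <= h (t + s) + e by apply: Hd'; [lra|apply/andP; split; lra].
  by rewrite addrK; lra.
(* Both bounds come from comparing the conserved quantity with windows on which
   h is nearly M, respectively nearly - m. *)
have MA : M * mu <= A.
  apply/ler_addgt0Pr => e e0.
  pose e1 := e / (2 * mu).
  have e10 : 0 < e1 by rewrite divr_gt0 ?mulr_gt0.
  have e20 : 0 < e / 2 by rewrite divr_gt0.
  have [T HT] := (cvg_pinftyP _ _).1 H_balance _ e20.
  have [t Tt Ht] := winM L e1 T e10.
  have := window_lower_bound aL Ht; have := HT t Tt.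
  rewrite ler_norml => /andP[_].
  have : e1 * mu = e / 2 by rewrite /e1; field; rewrite gt_eqF.
  by set x := H t - _; rewrite mulrBl; lra.
have mA : A <= - m * mu.
  apply/ler_addgt0Pr => e e0.
  pose e1 := e / (2 * mu).
  have e10 : 0 < e1 by rewrite divr_gt0 ?mulr_gt0.
  have e20 : 0 < e / 2 by rewrite divr_gt0.
  have [T HT] := (cvg_pinftyP _ _).1 H_balance _ e20.
  have [t Tt Ht] := winm L e1 T e10.
  have Ht' y : t - L <= y <= t -> h y <= - m + e1 by move=> /Ht; lra.
  have := window_upper_bound aL Ht'; have := HT t Tt.
  rewrite ler_norml => /andP[+ _].
  have : e1 * mu = e / 2 by rewrite /e1; field; rewrite gt_eqF.
  by set x := H t - _; rewrite mulrDl; lra.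
apply/cvg_pinftyP => e e0.
have [T1 HT1] := M1 e e0; have [T2 HT2] := m1 e e0.
exists (Num.max T1 T2) => t; rewrite ge_max => /andP[/HT1 h1 /HT2 h2].
have : M <= A / mu by rewrite ler_pdivlMr.
have : A / mu <= - m by rewrite ler_pdivrMr.
by rewrite ler_norml => ? ?; apply/andP; split; lra.
Qed.

(** Subtracting its expected linear growth from the primitive [H] leaves a
    function [K] with [K t <= max_n K (t - a n) + e] far out: [K] then grows by
    at most [e] per step of length at least [min a]. *)
Lemma subadditive_step_growth (K : R -> R) (T b C e : R) : 0 < b -> 0 <= e ->
  (forall n, b <= a n) ->
  (forall t, t <= T -> T - \sum_n a n <= t -> K t <= C) ->
  (forall t, T <= t -> K t <= \sum_n p n * K (t - a n) + e) ->
  forall t, T <= t -> K t <= C + e * ((t - T) / b + 1).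
Proof.
move=> b0 e0 ba KC Kstep.
have ab n : a n <= \sum_k a k.
  rewrite (bigD1 n) //= lerDl; apply: sumr_ge0 => k _; exact: ltW.
suff HK k t : T - \sum_n a n <= t -> t <= T + k%:R * b -> K t <= C + e * k%:R.
  move=> t Tt; pose k := (Num.truncn ((t - T) / b)).
  have /andP[k1 k2] : k%:R <= (t - T) / b < k.+1%:R.
    by apply: truncn_itv; apply: divr_ge0; [rewrite subr_ge0|exact: ltW].
  have sa : 0 <= \sum_n a n by apply: sumr_ge0 => n _; exact: ltW.
  apply: le_trans (HK k.+1 t _ _) _; first by lra.
    by move: k2; rewrite ltr_pdivrMr // => ?; lra.
  by rewrite lerD2l ler_wpM2l // -natr1; lra.
elim: k t => [|k IH] t t1 t2; first by rewrite mulr0 addr0; apply: KC => //; lra.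
have ek : 0 <= e * k%:R by rewrite mulr_ge0.
have [tT|/ltW Tt] := leP t T.
  by have := KC t tT t1; rewrite -natr1 mulrDr; lra.
apply: le_trans (Kstep t Tt) _.
have -> : C + e * k.+1%:R = (\sum_n p n * (C + e * k%:R)) + e.
  by rewrite -mulr_suml p_sum1 -natr1; ring.
rewrite lerD2r; apply: ler_sum => n _; apply: (ler_wpM2l (ltW (p_gt0 n))); apply: IH.
  by have := ab n; lra.
by have := ba n; move: t2; rewrite -natr1; lra.
Qed.

Lemma subadditive_step_growth_small (K : R -> R) :
  (forall T, exists C, forall t, t <= T -> T - \sum_n a n <= t -> K t <= C) ->
  (forall e : R, 0 < e -> exists T, forall t, T <= t ->
     K t <= \sum_n p n * K (t - a n) + e) ->
  forall e : R, 0 < e -> exists T, forall t, T <= t -> K t <= e * t.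
Proof.
move=> KC Kstep e e0.
have [b b0 ba] := steps_have_minimum a_gt0.
pose e1 := e / 2 * b.
have e10 : 0 < e1 by rewrite mulr_gt0 // divr_gt0.
have [T HT] := Kstep e1 e10; have [C HC] := KC T.
pose X := C - e / 2 * T + e1.
exists (Num.max T (2 * X / e)) => t; rewrite ge_max => /andP[Tt Xt].
have := subadditive_step_growth b0 (ltW e10) ba HC HT Tt.
have -> : e1 * ((t - T) / b + 1) = e / 2 * (t - T) + e1.
  by rewrite /e1; field; rewrite gt_eqF.
move: Xt; rewrite ler_pdivrMr // /X; lra.
Qed.

Lemma renewal_average : H t / t @[t --> +oo] --> A / mu.
Proof.
pose c := A / mu; have mu0 := mean_step_gt0.
have Hmono x y : x <= y -> H x <= H y.
  move=> xy.
  pose B := expR (theta * (y - x)) * h x.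
  have /andP[+ _] : 0 * (y - x) <= H y - H x <= B * (y - x).
    apply: MVT_bounds => // t /andP[t1 t2]; rewrite h_ge0 /=.
    have -> : t = x + (t - x) by ring.
    apply: le_trans (h_growth _ _) _; first by lra.
    by rewrite /B ler_wpM2r // ler_expR ler_wpM2l //; lra.
  by rewrite mul0r subr_ge0.
have sa : 0 <= \sum_n a n by apply: sumr_ge0 => n _; exact: ltW.
have win T t : t <= T -> T - \sum_n a n <= t -> `|c * t| <= `|c| * (`|T| + \sum_n a n).
  move=> t1 t2; rewrite normrM ler_wpM2l //.
  by have := ler_norm T; have := ler_norm (- T); rewrite normrN ler_norml => ? ?; apply/andP; split; lra.
have bal t : \sum_n p n * (H (t - a n) - c * (t - a n)) =
    \sum_n p n * H (t - a n) - c * t + A.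
  have -> : A = c * mu by rewrite /c divfK // gt_eqF.
  have -> : c * t = c * t * \sum_n p n by rewrite p_sum1 mulr1.
  rewrite /mu !mulr_sumr -sumrB -big_split /=; apply: eq_bigr => n _; ring.
have up : forall e : R, 0 < e -> exists T, forall t, T <= t -> H t - c * t <= e * t.
  apply: subadditive_step_growth_small => [T|e e0].
    exists (H T + `|c| * (`|T| + \sum_n a n)) => t t1 t2.
    have := win T t t1 t2; have := Hmono t T t1.
    by rewrite ler_norml => ? /andP[]; lra.
  have [T HT] := (cvg_pinftyP _ _).1 H_balance e e0.
  exists T => t /HT; rewrite bal ler_norml => /andP[_].
  by set x := \sum_n _; lra.
have lo : forall e : R, 0 < e -> exists T, forall t, T <= t -> c * t - H t <= e * t.
  apply: subadditive_step_growth_small => [T|e e0].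
    exists (`|c| * (`|T| + \sum_n a n) - H (T - \sum_n a n)) => t t1 t2.
    have := win T t t1 t2; have := Hmono _ _ t2.
    by rewrite ler_norml => ? /andP[]; lra.
  have [T HT] := (cvg_pinftyP _ _).1 H_balance e e0.
  exists T => t /HT; rewrite ler_norml => /andP[+ _].
  have -> : \sum_n p n * (c * (t - a n) - H (t - a n)) =
      - \sum_n p n * (H (t - a n) - c * (t - a n)).
    by rewrite -sumrN; apply: eq_bigr => n _; ring.
  by rewrite bal; set x := \sum_n _; lra.
apply/cvg_pinftyP => e e0.
have [T1 HT1] := up e e0; have [T2 HT2] := lo e e0.
exists (Num.max 1 (Num.max T1 T2)) => t; rewrite !ge_max => /and3P[t1 /HT1 h1 /HT2 h2].
have t0 : 0 < t by apply: lt_le_trans t1.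
have -> : H t / t - A / mu = (H t - c * t) / t by rewrite /c; field; rewrite !gt_eqF.
rewrite normrM normfV (gtr0_norm t0) ler_pdivrMr // ler_norml.
by apply/andP; split; lra.
Qed.

End Renewal.

(** * Sums, exponentials and primitives *)

Section CalculusHelpers.
Context {R : realType}.
Implicit Types (c t x : R).

Lemma cvg_finite_sum {T : Type} {F : set_system T} {FF : Filter F} {n : nat}
    (f : 'I_n -> T -> R) (l : 'I_n -> R) :
  (forall i, f i x @[x --> F] --> l i) ->
  (\sum_i f i x) @[x --> F] --> \sum_i l i.
Proof.
move=> fl; elim: (index_enum _) => [|i s IH].
  under eq_fun do rewrite big_nil.
  by rewrite big_nil; exact: cvg_cst.
under eq_fun do rewrite big_cons.
by rewrite big_cons; exact: cvgD.
Qed.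

Lemma is_derive_translate (f : R -> R) (df x c : R) :
  is_derive (x - c) 1 f df -> is_derive x 1 (fun t => f (t - c)) df.
Proof.
move=> Df; rewrite -[df]mulr1.
apply: (@is_derive1_comp _ f (fun t => t - c)) => //.
have -> : (fun t : R => t - c) = id - cst c by apply/funext.
by apply: is_derive_eq; rewrite subr0.
Qed.

Lemma is_derive_expR_linear c t :
  is_derive t 1 (fun s => expR (c * s)) (c * expR (c * t)).
Proof.
rewrite mulrC; apply: (@is_derive1_comp _ expR (fun s => c * s)).
have -> : (fun s : R => c * s) = c \*: id by apply/funext.
by apply: is_derive_eq; rewrite /GRing.scale /= mulr1.
Qed.

Lemma is_derive_linear_sum n (c : 'I_n -> R) (f : 'I_n -> R -> R)
    (df : 'I_n -> R) t :
  (forall i, is_derive t 1 (f i) (df i)) ->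
  is_derive t 1 (fun s => \sum_i c i * f i s) (\sum_i c i * df i).
Proof.
move=> Df; have -> : (fun s => \sum_i c i * f i s) = \sum_i (c i \*: f i).
  by apply/funext => s; rewrite fct_sumE.
by apply: is_derive_sum => i; exact: is_deriveZ.
Qed.

Lemma cvg_expR_decay c : 0 < c -> expR (- (c * t)) @[t --> +oo] --> (0 : R).
Proof.
move=> c0; apply: (@cvg_comp _ _ _ (fun t => c * t) (fun x => expR (- x)));
  last exact: cvgr_expR.
exact: gt0_cvgMry.
Qed.

(** A primitive prescribed on a half line. The difference [f - f0] vanishes to
    the left of [b], so that it is enough to integrate it from a finite point. *)
Lemma continuous_primitive_extending (f f0 F0 : R -> R) (b : R) :
  continuous f -> continuous f0 -> (forall t : R, is_derive t 1 F0 (f0 t)) ->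
  (forall t, t <= b -> f t = f0 t) ->
  exists2 F : R -> R, forall t : R, is_derive t 1 F (f t) &
    forall t, t <= b -> F t = F0 t.
Proof.
move=> cf cf0 dF0 ff0.
pose k t := f t - f0 t.
have ck : continuous k by move=> t; apply: cvgB; [exact: cf|exact: cf0].
pose K x := \int[lebesgue_measure]_(t in `[b - 1, x]) k t.
have K0 t : t <= b -> K t = 0.
  move=> tb; rewrite /K (@eq_Rintegral _ _ _ _ _ (fun=> 0)); last first.
    move=> s; rewrite inE /= in_itv /= => /andP[_ st].
    by rewrite /k ff0 ?subrr //; apply: le_trans tb.
  by rewrite /Rintegral integral0.
have dK (t : R) : is_derive t 1 K (k t).
  have [tb|bt] := ltP t b.
    apply: (@near_eq_is_derive _ _ _ (cst 0)).
      near=> s; rewrite K0 //; apply: ltW; near: s; exact: lt_nbhsl.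
    by rewrite /k ff0 ?subrr; [exact: is_derive_cst|exact: ltW].
  have [||||d1 d2] := @continuous_FTC1_closed R k (b - 1) t (t + 1).
  - by lra.
  - apply: continuous_compact_integrable; first exact: segment_compact.
    exact: continuous_subspaceT.
  - by lra.
  - exact: ck.
  apply: DeriveDef; first exact: d1.
  by rewrite -derive1E; exact: d2.
exists (F0 + K) => t; last by move=> tb; rewrite /= /GRing.add /= K0 // addr0.
have -> : f t = f0 t + k t by rewrite /k; ring.
exact: is_deriveD.
Unshelve. all: by end_near. Qed.

End CalculusHelpers.

(** * The tube function in logarithmic scale *)

(** The setting is [h t = expR (theta * t) * u (expR (- t))], where [u e] is the
    volume of the inner [e]-tube of the tiling. The polynomial [q] gives the tube
    volume of the generator up to the inradius [g], and [V] is the total volume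
    of the tiling, reached by the tube for [t <= tg]. Monotonicity of [u] is the
    growth condition on [h]. *)
Section LogarithmicTube.
Context {R : realType} {N : nat}.
Variables (p a : 'I_N -> R) (theta g V : R) (q : {poly R}) (h : R -> R).
Hypothesis N_gt0 : (0 < N)%N.
Hypothesis p_gt0 : forall n, 0 < p n.
Hypothesis p_sum1 : \sum_n p n = 1.
Hypothesis a_gt0 : forall n, 0 < a n.
Hypothesis theta_gt0 : 0 < theta.
Hypothesis theta_lt1 : theta < 1.
Hypothesis g_gt0 : 0 < g.
Hypothesis q_0 : q`_0 = 0.
Hypothesis q_ge0 : forall x, 0 < x <= g -> 0 <= q.[x].
Hypothesis q_g : 0 < q.[g].
Hypothesis h_ge0 : forall t, 0 <= h t.
Hypothesis h_growth : forall t s, 0 <= s -> h (t + s) <= expR (theta * s) * h t.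
Let tg := - ln g.
Hypothesis h_left : forall t, t <= tg -> h t = V * expR (theta * t).
Let z t := expR (theta * t) * q.[Num.min g (expR (- t))].
Hypothesis h_renewal : forall t, h t = z t + \sum_n p n * h (t - a n).

Let mu := \sum_n p n * a n.

(** The product of [theta] and the integral of [z] over the line. When [q] comes
    from a monophase generator, it is the constant [Gamma_coef]. *)
Definition tube_moment : R :=
  \sum_(j < size q) q`_j * (j%:R * g `^ (j%:R - theta) / (j%:R - theta)).

Lemma exponent_neq0 j : j%:R - theta != 0.
Proof.
case: j => [|j]; first by rewrite sub0r oppr_eq0 gt_eqF.
by apply: lt0r_neq0; rewrite -natr1; have := ler0n R j; move: theta_lt1; lra.
Qed.

Lemma expR_tg : expR (- tg) = g.
Proof. by rewrite opprK lnK. Qed.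

Lemma tg_leP t : (tg <= t) = (expR (- t) <= g).
Proof. by rewrite -expR_tg ler_expR lerN2. Qed.

Lemma z_left t : t <= tg -> z t = q.[g] * expR (theta * t).
Proof.
move=> tt; rewrite /z min_l ?[q.[g] * _]mulrC //.
by rewrite -expR_tg ler_expR lerN2.
Qed.

Lemma z_right t : tg <= t ->
  z t = \sum_(j < size q) q`_j * expR (- ((j%:R - theta) * t)).
Proof.
rewrite tg_leP => tt; rewrite /z min_r // horner_coef mulr_sumr.
apply: eq_bigr => j _; rewrite -expRM_natl mulrCA -expRD; congr (_ * expR _).
by ring.
Qed.

Lemma z_ge0 t : 0 <= z t.
Proof.
rewrite mulr_ge0 ?expR_ge0 // q_ge0 // lt_min g_gt0 expR_gt0 /=.
by rewrite ge_min lexx.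
Qed.

Lemma z_continuous : continuous z.
Proof.
move=> t; apply: cvgM.
  apply: (@continuous_comp _ _ _ (fun t => theta * t) expR); last exact: continuous_expR.
  exact: cvgMr.
apply: (@continuous_comp _ _ _ (fun t => Num.min g (expR (- t))) (horner q));
  last exact: continuous_horner.
apply: (@continuous_min R _ (fun=> g) (fun t => expR (- t))); first exact: cvg_cst.
apply: (@continuous_comp _ _ _ (fun t => - t) expR); last exact: continuous_expR.
exact: continuousN.
Qed.

Lemma z_terms_cvg0 (c : nat -> R) :
  \sum_(j < size q) q`_j * (c j * expR (- ((j%:R - theta) * t)))
    @[t --> +oo] --> (0 : R).
Proof.
have E0 : (0 : R) = \sum_(j < size q) 0 by rewrite big1.
rewrite [X in _ --> X]E0; apply: cvg_finite_sum => -[[|j] hj] /=.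
  by rewrite q_0; under eq_fun do rewrite mul0r; exact: cvg_cst.
rewrite -[X in _ --> X](mulr0 q`_j.+1); apply: cvgMr.
rewrite -[X in _ --> X](mulr0 (c j.+1)); apply: cvgMr.
apply: cvg_expR_decay => //.
by rewrite -natr1; have := ler0n R j; move: theta_lt1; lra.
Qed.

Lemma z_cvg0 : z t @[t --> +oo] --> (0 : R).
Proof.
have := z_terms_cvg0 (fun=> 1); apply: cvg_trans; apply: near_eq_cvg.
exists tg; split; first exact: num_real.
move=> t /ltW tt; rewrite z_right //.
by apply: eq_bigr => j _; rewrite mul1r.
Qed.

(** The equation expresses [h] at [t] by its values at the points [t - a n], so
    that continuity propagates from the left half line by steps of length at
    least [min a]. *)
Lemma h_continuous : continuous h.
Proof.
have [b b0 ba] := steps_have_minimum a_gt0.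
suff H k t : t < tg + k%:R * b -> {for t, continuous h}.
  move=> t; pose k := (Num.truncn (`|t - tg| / b)).+1.
  apply: (H k); have := truncnS_gt (`|t - tg| / b).
  by rewrite -/k ltr_pdivrMr // => ?; have := ler_norm (t - tg); lra.
elim: k t => [|k IH] t tk.
  have c0 : {for t, continuous (fun t => V * expR (theta * t))}.
    apply: cvgMr.
    apply: (@continuous_comp _ _ _ (fun t => theta * t) expR); last exact: continuous_expR.
    exact: cvgMr.
  have tt : t < tg by move: tk; rewrite mul0r addr0.
  change (h x @[x --> t] --> h t); rewrite h_left ?ltW //.
  apply: cvg_trans c0; apply: near_eq_cvg.
  by near=> s; rewrite h_left // ltW //; near: s; exact: lt_nbhsl.
have -> : h = (fun t => z t + \sum_n p n * h (t - a n)).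
  by apply/funext => s; exact: h_renewal.
apply: cvgD; first exact: z_continuous.
apply: cvg_finite_sum => n; apply: cvgMr.
apply: (@continuous_comp _ _ _ (fun t => t - a n) h).
  by apply: cvgB; [exact: cvg_id|exact: cvg_cst].
by apply: IH; have := ba n; move: tk; rewrite -natr1; lra.
Unshelve. all: by end_near. Qed.

Lemma h_primitive : exists2 H : R -> R, forall t : R, is_derive t 1 H (h t) &
  forall t, t <= tg -> H t = V / theta * expR (theta * t).
Proof.
apply: (@continuous_primitive_extending _ h (fun t => V * expR (theta * t))) => //.
- exact: h_continuous.
- move=> t; apply: cvgMr.
  apply: (@continuous_comp _ _ _ (fun t => theta * t) expR); last exact: continuous_expR.
  exact: cvgMr.
- move=> t.
  have -> : V * expR (theta * t) = V / theta * (theta * expR (theta * t)).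
    by field; rewrite gt_eqF.
  apply: (@is_deriveZ _ _ _ (fun s => expR (theta * s))).
  exact: is_derive_expR_linear.
Qed.

(** On the left, where the tubes are the whole sets, the renewal equation only
    balances total volumes. *)
Lemma mass_balance t : t <= tg ->
  V * expR (theta * t) - \sum_n p n * (V * expR (theta * (t - a n))) =
  q.[g] * expR (theta * t).
Proof.
move=> tt; have := h_renewal t; rewrite z_left // h_left // => ->.
rewrite -[RHS]addr0 -addrA; congr (_ + _).
apply/eqP; rewrite subr_eq0; apply/eqP/eq_bigr => n _; rewrite h_left //.
by have := a_gt0 n; lra.
Qed.

Lemma V_gt0 : 0 < V.
Proof.
have e0 := expR_gt0 (theta * tg).
rewrite -(pmulr_lgt0 _ e0) -h_left // h_renewal z_left //.
apply: ltr_pwDl; first by rewrite mulr_gt0.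
by apply: sumr_ge0 => n _; rewrite mulr_ge0 // ltW.
Qed.

Section Balance.
Variable H : R -> R.
Hypothesis H_derive : forall t : R, is_derive t 1 H (h t).
Hypothesis H_left : forall t, t <= tg -> H t = V / theta * expR (theta * t).

Let E t := H t - \sum_n p n * H (t - a n).

Lemma balance_derive (t : R) : is_derive t 1 E (z t).
Proof.
have -> : z t = h t - \sum_n p n * h (t - a n) by rewrite h_renewal addrK.
apply: (@is_deriveB _ _ _ H (fun t => \sum_n p n * H (t - a n))) => //.
by apply: is_derive_linear_sum => n; apply: is_derive_translate.
Qed.

Lemma balance_left : E tg = q.[g] / theta * expR (theta * tg).
Proof.
rewrite /E H_left //.
under eq_bigr => n _.
  rewrite H_left; last by rewrite gerBl ltW.
  over.
rewrite [RHS]mulrAC -mass_balance // mulrBl; congr (_ - _); first by rewrite mulrAC.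
by rewrite mulr_suml; apply: eq_bigr => n _; ring.
Qed.

Let tail (t : R) : R :=
  \sum_(j < size q) q`_j * ((j%:R - theta)^-1 * expR (- ((j%:R - theta) * t))).

Lemma balance_right t : tg <= t -> E t + tail t = E tg + tail tg.
Proof.
move=> tt.
have dtail (s : R) : is_derive s 1 tail
    (\sum_(j < size q) q`_j * (- expR (- ((j%:R - theta) * s)))).
  apply: is_derive_linear_sum => j.
  have -> : (fun s => (j%:R - theta)^-1 * expR (- ((j%:R - theta) * s))) =
      (j%:R - theta)^-1 \*: (fun s => expR (- (j%:R - theta) * s)).
    by apply/funext => u; rewrite /= mulNr.
  have -> : - expR (- ((j%:R - theta) * s)) = (j%:R - theta)^-1 *:
      (- (j%:R - theta) * expR (- (j%:R - theta) * s)).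
    rewrite -[RHS]/(_ * _) mulNr mulrN mulNr; congr (- _).
    by rewrite mulKf // exponent_neq0.
  by apply: is_deriveZ; exact: is_derive_expR_linear.
have dEt (s : R) : is_derive s 1 (E + tail)
    (z s + \sum_(j < size q) q`_j * (- expR (- ((j%:R - theta) * s)))).
  exact: (is_deriveD (balance_derive s) (dtail s)).
have [s /andP[s1 s2] Es] := MVT_segment tt (fun s _ => dEt s)
  (derivable_within_continuous (fun s _ => @ex_derive _ _ _ _ _ _ _ (dEt s))).
apply/eqP; rewrite -subr_eq0 [X in X == 0]Es z_right //.
under [X in _ + X]eq_bigr do rewrite mulrN.
by rewrite sumrN subrr mul0r.
Qed.

Lemma balance_limitE : E tg + tail tg = tube_moment / theta.
Proof.
rewrite balance_left horner_coef /tube_moment /tail !mulr_suml -big_split /=.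
apply: eq_bigr => j _.
have gj : g `^ (j%:R - theta) = g ^+ j * expR (theta * tg).
  rewrite /powR gt_eqF // mulrBl expRB expRM_natl lnK // /tg mulrN expRN.
  by [].
have -> : expR (- ((j%:R - theta) * tg)) = g `^ (j%:R - theta).
  by rewrite /powR gt_eqF // /tg mulrN opprK.
rewrite gj; field; rewrite exponent_neq0 gt_eqF //.
Qed.

(** The derivative of [E] is the source term [z]; to the right of [tg] this is a
    sum of decaying exponentials, whose primitive is [- tail]. *)
Lemma H_balance : E t @[t --> +oo] --> tube_moment / theta.
Proof.
have T0 := z_terms_cvg0 (fun j => (j%:R - theta)^-1).
have : tube_moment / theta - tail t @[t --> +oo] --> tube_moment / theta - 0.
  by apply: cvgB; [exact: cvg_cst|exact: T0].
rewrite subr0; apply: cvg_trans; apply: near_eq_cvg.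
exists tg; split; first exact: num_real.
by move=> t /ltW tt; rewrite -balance_limitE -(balance_right tt) addrK.
Qed.

Lemma balance_limit_gt0 : 0 < tube_moment.
Proof.
rewrite -(pmulr_lgt0 _ (_ : 0 < theta^-1)) ?invr_gt0 //.
have E0 : 0 < E tg by rewrite balance_left mulr_gt0 ?divr_gt0 ?expR_gt0.
apply: (lt_le_trans E0); rewrite -(cvg_lim _ H_balance) //.
apply: limr_ge; first by apply/cvg_ex; exists (tube_moment / theta); exact: H_balance.
exists tg; split; first exact: num_real.
move=> t /ltW tt.
have [c _ Ec] := MVT_segment tt (fun s _ => balance_derive s)
  (derivable_within_continuous (fun s _ => @ex_derive _ _ _ _ _ _ _ (balance_derive s))).
by rewrite -subr_ge0 Ec mulr_ge0 ?z_ge0 // subr_ge0.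
Qed.

End Balance.

Lemma tube_moment_gt0 : 0 < tube_moment.
Proof. by have [H dH H0] := h_primitive; exact: balance_limit_gt0 dH H0. Qed.

Lemma log_tube_bounded T0 : exists B, forall t, T0 <= t -> h t <= B.
Proof.
have [H dH H0] := h_primitive.
exact: (renewal_bounded N_gt0 p_gt0 p_sum1 a_gt0 (ltW theta_gt0) h_ge0 h_growth
  dH (H_balance dH H0)).
Qed.

Lemma log_tube_cvg_nonlattice :
  ~ (exists2 l : R, 0 < l &
     exists k : 'I_N -> nat, forall n, (0 < k n)%N /\ a n = (k n)%:R * l) ->
  h t @[t --> +oo] --> tube_moment / theta / mu.
Proof.
move=> nl; have [H dH H0] := h_primitive.
apply: (renewal_dense_cvg N_gt0 p_gt0 p_sum1 a_gt0 (ltW theta_gt0) h_ge0 h_growth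
  h_renewal z_cvg0 dH (H_balance dH H0)) => x y xy.
exact: nonlattice_dense.
Qed.

Lemma log_tube_average : exists2 H : R -> R, forall t : R, is_derive t 1 H (h t) &
  H t / t @[t --> +oo] --> tube_moment / theta / mu.
Proof.
have [H dH H0] := h_primitive; exists H => //.
exact: (renewal_average N_gt0 p_gt0 p_sum1 a_gt0 (ltW theta_gt0) h_ge0 h_growth
  dH (H_balance dH H0)).
Qed.

Section Lattice.
Variables (l : R) (k : 'I_N -> nat).
Hypothesis l_gt0 : 0 < l.
Hypothesis k_gt0 : forall n, (0 < k n)%N.
Hypothesis a_lattice : forall n, a n = (k n)%:R * l.

Let ladder (tau : R) m := \sum_n p n * \sum_(i < k n) h (tau + m%:R * l - i%:R * l).

(** The discrete conservation law: along an arithmetic progression of step [l]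
    the inner sums telescope. *)
Lemma ladder_succ tau m :
  ladder tau m.+1 = ladder tau m + z (tau + m.+1%:R * l).
Proof.
set t := tau + m.+1%:R * l.
have tele j : \sum_(i < j) h (t - i%:R * l) =
    \sum_(i < j) h (tau + m%:R * l - i%:R * l) + h t - h (t - j%:R * l).
  elim: j => [|j IH]; first by rewrite !big_ord0 mul0r subr0; ring.
  rewrite !big_ord_recr /= IH.
  have -> : t - j.+1%:R * l = tau + m%:R * l - j%:R * l.
    by rewrite /t -!natr1; ring.
  by ring.
have -> : z t = h t - \sum_n p n * h (t - a n) by rewrite h_renewal addrK.
rewrite /ladder; under eq_bigr do rewrite tele.
under eq_bigr do rewrite mulrBr mulrDr.
rewrite sumrB big_split /= -mulr_suml p_sum1 mul1r addrA; congr (_ - _).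
by apply: eq_bigr => n _; rewrite a_lattice.
Qed.

Lemma ladderE tau m :
  ladder tau m = ladder tau 0 + \sum_(1 <= j < m.+1) z (tau + j%:R * l).
Proof.
elim: m => [|m IH]; first by rewrite big_geq // addr0.
by rewrite ladder_succ IH [in RHS]big_nat_recr //= addrA.
Qed.

Let weight := V * \sum_n p n * \sum_(i < k n) expR (- (theta * (i%:R * l))).

Lemma weight_gt0 : 0 < weight.
Proof.
rewrite mulr_gt0 ?V_gt0 //.
have term n : 0 < p n * \sum_(i < k n) expR (- (theta * (i%:R * l))).
  rewrite mulr_gt0 // (bigD1 (Ordinal (k_gt0 n))) //= ltr_pwDl ?expR_gt0 //.
  by apply: sumr_ge0 => i _; exact: expR_ge0.
rewrite (bigD1 (Ordinal N_gt0)) //= ltr_pwDl //.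
by apply: sumr_ge0 => n _; rewrite ltW.
Qed.

Lemma ladder0 tau : tau <= tg -> ladder tau 0 = weight * expR (theta * tau).
Proof.
move=> tt; rewrite /ladder /weight mulrAC -[RHS]mulrC mulr_suml.
apply: eq_bigr => n _; rewrite -mulrA; congr (_ * _); rewrite mulr_suml.
apply: eq_bigr => i _; rewrite mul0r addr0 h_left; last first.
  have : 0 <= i%:R * l by rewrite mulr_ge0 // ltW.
  by lra.
by rewrite mulrBr expRB expRN; ring.
Qed.

(** If [h] converged, the discrete conservation law would force an exponential
    polynomial in [tau], with the exponent [theta] of positive weight, to be
    constant on an interval; its derivative, read as a polynomial in
    [expR (- tau)], would vanish although its constant coefficient does not. *)
Lemma log_tube_not_cvg_lattice (L : R) : ~ (h t @[t --> +oo] --> L).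
Proof.
move=> /cvg_pinftyP hL.
pose C := \sum_n p n * (\sum_(i < k n) L).
have ladder_cvg tau : ladder tau m @[m --> \oo] --> C.
  apply: cvg_finite_sum => n; apply: cvgMr; apply: cvg_finite_sum => i.
  apply/cvgrPdist_le => e e0; have [T HT] := hL e e0.
  exists (Num.truncn (`|T - tau + i%:R * l| / l)).+1 => // m /= mT.
  rewrite distrC; apply: HT.
  have : `|T - tau + i%:R * l| < m%:R * l.
    rewrite -ltr_pdivrMr //; apply: lt_le_trans (truncnS_gt _) _.
    by rewrite ler_nat.
  by have := ler_norm (T - tau + i%:R * l); lra.
pose x (j : nat) := expR (- ((j%:R - theta) * l)).
pose c (j : nat) := x j / (1 - x j).
have cvg_c (j : nat) : (0 < j)%N -> series (geometric (x j) (x j)) m @[m --> \oo] --> c j.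
  move=> j0; apply: cvg_geometric_series.
  rewrite ger0_norm ?expR_ge0 // -[ltRHS]expR0 ltr_expR oppr_lt0 mulr_gt0 //.
  by rewrite subr_gt0; apply: lt_le_trans theta_lt1 _; rewrite ler1n.
have const tau : tg - l < tau -> tau <= tg -> weight * expR (theta * tau) +
    \sum_(j < size q) q`_j * (c j * expR (- ((j%:R - theta) * tau))) = C.
  move=> t1 t2; apply/esym/(cvg_unique _ (ladder_cvg tau)) => //.
  rewrite /=; under eq_fun do rewrite ladderE ladder0 //.
  apply: cvgD; first exact: cvg_cst.
  have E m : \sum_(1 <= j < m.+1) z (tau + j%:R * l) =
      \sum_(j < size q) q`_j * (series (geometric (x j) (x j)) m *
         expR (- ((j%:R - theta) * tau))).
    rewrite big_add1 /=.
    under eq_bigr => i _.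
      rewrite z_right; last first.
        have : 0 <= i%:R * l by rewrite mulr_ge0 // ltW.
        by rewrite -natr1; lra.
      over.
    rewrite exchange_big /=; apply: eq_bigr => j _.
    rewrite -mulr_sumr; congr (_ * _); rewrite /series /= mulr_suml.
    apply: eq_bigr => i _; rewrite -exprS -expRM_natl -expRD; congr expR.
    by ring.
  under eq_fun do rewrite E.
  apply: cvg_finite_sum => -[[|j] hj] /=.
    by rewrite q_0 mul0r; under eq_fun do rewrite mul0r; exact: cvg_cst.
  by apply: cvgMr; apply: cvgMl; exact: cvg_c.
pose P : {poly R} := (theta * weight)%:P -
  \poly_(j < size q) (q`_j * (c j * (j%:R - theta))).
have P0 : P`_0 = theta * weight.
  rewrite /P coefB coefC eqxx coef_poly; case: ifP => _; last by rewrite subr0.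
  by rewrite q_0 mul0r subr0.
have Proot tau : tg - l < tau < tg -> P.[expR (- tau)] = 0.
  move=> /andP[t1 t2].
  pose f t := weight * expR (theta * t) +
    \sum_(j < size q) q`_j * (c j * expR (- ((j%:R - theta) * t))).
  have df : is_derive tau 1 f (weight * (theta * expR (theta * tau)) +
      \sum_(j < size q) q`_j * (c j * (- (j%:R - theta) * expR (- ((j%:R - theta) * tau))))).
    apply: is_deriveD.
      by apply: is_deriveZ; exact: is_derive_expR_linear.
    apply: is_derive_linear_sum => j; apply: is_deriveZ.
    have -> : (fun s => expR (- ((j%:R - theta) * s))) =
        (fun s => expR (- (j%:R - theta) * s)).
      by apply/funext => s; rewrite mulNr.
    by rewrite -mulNr; exact: is_derive_expR_linear.
  have df0 : is_derive tau 1 f 0.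
    apply: (@near_eq_is_derive _ _ _ (cst C)).
    near=> s; rewrite /f const //.
      by near: s; exact: lt_nbhsr.
    by apply/ltW; near: s; exact: lt_nbhsl.
  have := @derive_val _ _ _ _ _ _ _ df; rewrite (@derive_val _ _ _ _ _ _ _ df0).
  move=> /esym E0; rewrite -[RHS](mulr0 (expR (- (theta * tau)))) -E0.
  rewrite /P hornerD hornerN hornerC horner_poly mulrDr mulr_sumr; congr (_ + _).
    rewrite expRN; field; rewrite gt_eqF // expR_gt0 //.
  rewrite -sumrN; apply: eq_bigr => j _; rewrite -expRM_natl.
  have -> : expR (j%:R * - tau) =
      expR (- (theta * tau)) * expR (- ((j%:R - theta) * tau)).
    by rewrite -expRD; congr expR; ring.
  by ring.
have Pneq0 : P != 0.
  apply/eqP => /(congr1 (fun r : {poly R} => r`_0)); rewrite P0 coef0.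
  by apply/eqP; rewrite gt_eqF // mulr_gt0 // weight_gt0.
pose point i := tg - l * (i.+1%:R / (size P).+1%:R).
pose rs := [seq expR (- point i) | i <- iota 0 (size P)].
have := @max_poly_roots _ P rs Pneq0; rewrite size_map size_iota ltnn => H.
suff : false by []; apply: H.
  apply/(@seq.allP R) => _ /mapP[i + ->]; rewrite mem_iota add0n /= => ip.
  apply/rootP; apply: Proot; rewrite /point.
  have s0 : 0 < (size P).+1%:R :> R by rewrite ltr0n.
  have f1 : i.+1%:R / (size P).+1%:R < 1 :> R.
    by rewrite ltr_pdivrMr // mul1r ltr_nat ltnS.
  have f0 : 0 < i.+1%:R / (size P).+1%:R :> R by rewrite divr_gt0 // ltr0n.
  have : 0 < l * (i.+1%:R / (size P).+1%:R) by rewrite mulr_gt0.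
  have : l * (i.+1%:R / (size P).+1%:R) < l * 1 by rewrite ltr_pM2l.
  set y := l * (_ / _); rewrite mulr1 => y1 y2.
  by apply/andP; split; lra.
rewrite map_inj_uniq ?iota_uniq // => i j /expR_inj /oppr_inj.
rewrite /point => /addrI /oppr_inj /(mulfI (lt0r_neq0 l_gt0)).
move=> /(mulIf _) => /(_ _)/eqP; rewrite eqr_nat eqSS => /(_ _)/eqP; apply.
by rewrite invr_eq0 pnatr_eq0.
Unshelve. all: by end_near. Qed.

End Lattice.

End LogarithmicTube.

(** * Euclidean distance and similarities *)

Section EuclideanDistance.
Context {R : realType} {d : nat}.
Implicit Types (x y z : 'rV[R]_d) (A B U T : set 'rV[R]_d).

Definition dot x y : R := \sum_(j < d) x 0 j * y 0 j.

Lemma dotC x y : dot x y = dot y x.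
Proof. by apply: eq_bigr => j _; rewrite mulrC. Qed.

Lemma dotDl x y z : dot (x + y) z = dot x z + dot y z.
Proof. by rewrite -big_split; apply: eq_bigr => j _; rewrite mxE mulrDl. Qed.

Lemma dotNl x z : dot (- x) z = - dot x z.
Proof. by rewrite -sumrN; apply: eq_bigr => j _; rewrite mxE mulNr. Qed.

Lemma dotDr x y z : dot x (y + z) = dot x y + dot x z.
Proof. by rewrite dotC dotDl !(dotC _ x). Qed.

Lemma dotNr x z : dot x (- z) = - dot x z.
Proof. by rewrite dotC dotNl dotC. Qed.

Lemma dot_ge0 x : 0 <= dot x x.
Proof. by apply: sumr_ge0 => j _; rewrite -expr2 sqr_ge0. Qed.

Lemma dot_delta x j : dot x (delta_mx 0 j) = x 0 j.
Proof.
rewrite /dot (bigD1 j) //= mxE !eqxx mulr1 big1 ?addr0 // => i /negbTE ij.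
by rewrite mxE ij andbF mulr0.
Qed.

Lemma eucl_distE x y : eucl_dist x y = Num.sqrt (dot (x - y) (x - y)).
Proof.
by congr Num.sqrt; apply: eq_bigr => j _; rewrite !mxE -expr2.
Qed.

Lemma eucl_dist_ge0 x y : 0 <= eucl_dist x y.
Proof. exact: sqrtr_ge0. Qed.

Lemma eucl_dist_sqr x y : eucl_dist x y ^+ 2 = dot (x - y) (x - y).
Proof. by rewrite eucl_distE sqr_sqrtr // dot_ge0. Qed.

Lemma cauchy_schwarz x y : dot x y ^+ 2 <= dot x x * dot y y.
Proof.
rewrite -subr_ge0.
suff -> : dot x x * dot y y - dot x y ^+ 2 =
    2^-1 * \sum_(i < d) \sum_(j < d) (x 0 i * y 0 j - x 0 j * y 0 i) ^+ 2.
  rewrite mulr_ge0 ?invr_ge0 //; apply: sumr_ge0 => i _.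
  by apply: sumr_ge0 => j _; exact: sqr_ge0.
have -> : \sum_(i < d) \sum_(j < d) (x 0 i * y 0 j - x 0 j * y 0 i) ^+ 2 =
    dot x x * dot y y + dot y y * dot x x - 2 * (dot x y * dot x y).
  rewrite /dot !big_distrlr /= mulr_sumr -big_split -sumrB /=.
  apply: eq_bigr => i _; rewrite mulr_sumr -big_split -sumrB /=.
  by apply: eq_bigr => j _; ring.
by field.
Qed.

Lemma eucl_dist_triangle y x z : eucl_dist x z <= eucl_dist x y + eucl_dist y z.
Proof.
rewrite -(ler_pXn2r (n := 2)) ?nnegrE ?addr_ge0 ?eucl_dist_ge0 //.
rewrite sqrrD !eucl_dist_sqr.
have -> : x - z = (x - y) + (y - z) by rewrite addrA subrK.
have uv : dot (x - y) (y - z) <= eucl_dist x y * eucl_dist y z.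
  apply: le_trans (ler_norm _) _.
  rewrite -(ler_pXn2r (n := 2)) ?nnegrE ?mulr_ge0 ?eucl_dist_ge0 //.
  by rewrite real_normK ?num_real // exprMn !eucl_dist_sqr cauchy_schwarz.
move: (x - y) (y - z) uv => u v uv.
by rewrite dotDl !dotDr (dotC v u) mulr2n; lra.
Qed.

Lemma coord_le_eucl_dist x y j : `|x 0 j - y 0 j| <= eucl_dist x y.
Proof.
rewrite -(ler_pXn2r (n := 2)) ?nnegrE ?eucl_dist_ge0 //.
rewrite real_normK ?num_real // eucl_dist_sqr /dot (bigD1 j) //= !mxE -expr2 lerDl.
by apply: sumr_ge0 => i _; rewrite -expr2 sqr_ge0.
Qed.

Lemma eucl_dist_le_coord x y e : (forall j, `|x 0 j - y 0 j| <= e) ->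
  eucl_dist x y <= d%:R * e.
Proof.
case: (posnP d) => [d0 _|d0 He].
  rewrite /eucl_dist big1 ?sqrtr0 ?d0 ?mul0r // => j _.
  by have := ltn_ord j; rewrite [X in (_ < X)%N]d0.
have e0 : 0 <= e by apply: le_trans (He (Ordinal d0)).
rewrite -(ler_pXn2r (n := 2)) ?nnegrE ?eucl_dist_ge0 ?mulr_ge0 //.
rewrite eucl_dist_sqr /dot; apply: (@le_trans _ _ (\sum_(j < d) e ^+ 2)).
  apply: ler_sum => j _; rewrite !mxE -expr2 -[leLHS]real_normK ?num_real //.
  by rewrite ler_pXn2r ?nnegrE.
have -> : \sum_(j < d) e ^+ 2 = d%:R * e ^+ 2.
  by rewrite sumr_const card_ord mulr_natl.
rewrite exprMn ler_wpM2r ?sqr_ge0 //.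
by rewrite -natrX ler_nat leq_pmulr.
Qed.

Lemma open_euclP A :
  open A <-> forall x, A x -> exists2 e : R, 0 < e & eucl_ball x e `<=` A.
Proof.
split=> [oA x Ax|H].
  have /nbhs_ballP[e /= e0 He] := open_nbhs_nbhs (conj oA Ax).
  exists e => // y xy; apply: He; split => // i j; rewrite (ord1 i) /ball /=.
  by apply: le_lt_trans (coord_le_eucl_dist _ _ _) xy.
rewrite openE => x /H[e e0 He]; apply/nbhs_ballP.
have d0 : 0 < d.+1%:R :> R by rewrite ltr0n.
exists (e / d.+1%:R) => /=; first by rewrite divr_gt0.
move=> y [_ xy]; apply: He; rewrite /eucl_ball /=.
apply: (@le_lt_trans _ _ (d%:R * (e / d.+1%:R))).
  by apply: eucl_dist_le_coord => j; have := xy 0 j; rewrite /ball /= => /ltW.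
by rewrite mulrCA gtr_pMr // ltr_pdivrMr // mul1r ltr_nat.
Qed.

Lemma dist_to_le x y A : A y -> dist_to x A <= eucl_dist x y.
Proof.
move=> Ay; apply: ge_inf; last by exists y.
by exists 0 => _ [w _ <-]; exact: eucl_dist_ge0.
Qed.

Lemma dist_to_ge x A e : A !=set0 -> (forall y, A y -> e <= eucl_dist x y) ->
  e <= dist_to x A.
Proof.
move=> [y Ay] He; apply: lb_le_inf; first by exists (eucl_dist x y), y.
by move=> _ [w Aw <-]; exact: He.
Qed.

Lemma dist_to_lipschitz x y A : A !=set0 ->
  dist_to x A <= eucl_dist x y + dist_to y A.
Proof.
move=> A0; rewrite -lerBlDl; apply: dist_to_ge => // w Aw.
by rewrite lerBlDl; apply: le_trans (dist_to_le x Aw) (eucl_dist_triangle _ _ _).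
Qed.

Lemma open_dist_to_gt A B e : open A -> B !=set0 ->
  open [set x | A x /\ e < dist_to x B].
Proof.
move=> /open_euclP oA B0; apply/open_euclP => x [/oA[s s0 sA] ex].
exists (Num.min s (dist_to x B - e)); first by rewrite lt_min s0 subr_gt0.
move=> y; rewrite /eucl_ball /= lt_min => /andP[ys yd]; split; first exact: sA.
by have := dist_to_lipschitz x y B0; lra.
Qed.

Lemma dist_to_gt0 x A : open A -> ~` A !=set0 -> A x -> 0 < dist_to x (~` A).
Proof.
move=> /open_euclP oA A0 /oA[e e0 eA]; apply: (lt_le_trans e0).
apply: dist_to_ge => // y nAy; rewrite leNgt; apply/negP => xy.
by apply: nAy; exact: eA.
Qed.

(** A segment is connected, so that it cannot leave [U] inside [T], where [U] is
    open and closed: the segment from [x] to [y] contains a point outside [T]. *)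
Lemma segment_leaves U T x y : open U -> open (T `\` U) -> U `<=` T ->
  U x -> ~ U y -> exists2 w, ~ T w & eucl_dist x w <= eucl_dist x y.
Proof.
move=> oU oTU UT Ux nUy; apply: contrapT => nw.
pose c (s : R) : 'rV[R]_d := x + s *: (y - x).
have dc s : 0 <= s <= 1 -> eucl_dist x (c s) <= eucl_dist x y.
  move=> /andP[s0 s1].
  have -> : eucl_dist x (c s) = s * eucl_dist x y.
    rewrite /eucl_dist -[s in RHS](ger0_norm s0) -sqrtr_sqr -sqrtrM ?sqr_ge0 //.
    congr Num.sqrt; rewrite mulr_sumr; apply: eq_bigr => j _.
    by rewrite !mxE; ring.
  by rewrite ler_piMl // eucl_dist_ge0.
have Tc s : 0 <= s <= 1 -> T (c s).
  by move=> s01; apply: contrapT => nT; apply: nw; exists (c s) => //; exact: dc.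
have cc : continuous c.
  by move=> s; apply: cvgD; [exact: cvg_cst|apply: cvgZl; exact: cvg_id].
pose B := `[0, 1]%classic `&` c @^-1` U.
have : B = `[0, 1]%classic.
  apply: (@segment_connected R 0 1).
  - exists 0; split; first by rewrite /= in_itv /= lexx ler01.
    by rewrite /preimage /= /c scale0r addr0.
  - by exists (c @^-1` U) => //; exact: open_comp.
  - exists (~` (c @^-1` (T `\` U))).
      by apply: open_closedC; exact: open_comp.
    apply/seteqP; split=> s [s01 Hs]; split=> //; first by move=> [].
    apply: contrapT => nU; apply: Hs; split=> //; apply: Tc.
    by move: s01; rewrite /= in_itv.
move=> /seteqP[_ /(_ 1)] []; first by rewrite /= in_itv /= lexx ler01.
by rewrite /preimage /= /c scale1r addrC subrK.
Qed.

(** This locality is what splits the inner tube of a union of disjoint open sets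
    into the inner tubes of these sets, even if their closures touch. *)
Lemma dist_to_clopen_part U T x : open U -> open (T `\` U) -> U `<=` T ->
  ~` T !=set0 -> U x -> dist_to x (~` T) = dist_to x (~` U).
Proof.
move=> oU oTU UT T0 Ux.
have U0 : ~` U !=set0 by case: T0 => y nTy; exists y => /UT.
apply/le_anti/andP; split.
  apply: dist_to_ge => // y nUy.
  have [w nTw] := segment_leaves oU oTU UT Ux nUy.
  by apply: le_trans; exact: dist_to_le.
by apply: dist_to_ge => // y nTy; apply: dist_to_le => /UT.
Qed.

Lemma dist_to_le_inradius A g x : is_inradius A g -> ~` A !=set0 ->
  open A -> A x -> dist_to x (~` A) <= g.
Proof.
move=> [g0 _ gmax] A0 oA Ax; apply: (gmax x); first exact: dist_to_gt0.
move=> y xy; apply: contrapT => nAy.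
have nAy' : (~` A) y by [].
by have := dist_to_le x nAy'; rewrite leNgt xy.
Qed.

End EuclideanDistance.

Section Similarity.
Context {R : realType} {d : nat}.
Variables (rho : R) (f : 'rV[R]_d -> 'rV[R]_d).
Hypothesis rho_gt0 : 0 < rho.
Hypothesis sim_f : similarity rho f.

(** Polarization turns preservation of distances into preservation of inner
    products of the differences [f x - f 0], so that the matrix [M] of the images
    of the basis vectors satisfies [(f x - f 0) M^T = rho ^ 2 x]. *)
Lemma similarity_affine : exists2 M : 'M[R]_d,
  M *m M^T = (rho ^+ 2)%:M & forall x, f x = x *m M + f 0.
Proof.
pose g x := f x - f 0.
have distg x y : dot (g x - g y) (g x - g y) = rho ^+ 2 * dot (x - y) (x - y).
  rewrite -!eucl_dist_sqr -exprMn -sim_f !eucl_dist_sqr.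
  by rewrite /g opprB addrA subrK.
have g0 : g 0 = 0 by rewrite /g subrr.
have normg x : dot (g x) (g x) = rho ^+ 2 * dot x x.
  by have := distg x 0; rewrite g0 !subr0.
have expand (u v : 'rV[R]_d) : dot (u - v) (u - v) = dot u u + dot v v - 2 * dot u v :> R.
  by rewrite dotDl dotNl !dotDr !dotNr (dotC v u); ring.
have dotg x y : dot (g x) (g y) = rho ^+ 2 * dot x y.
  by have := distg x y; rewrite (expand (g x) (g y)) (expand x y) !normg; lra.
pose M : 'M[R]_d := \matrix_(i < d) g (delta_mx 0 i).
have MMT : M *m M^T = (rho ^+ 2)%:M.
  apply/matrixP => i j; rewrite !mxE.
  transitivity (dot (g (delta_mx 0 i)) (g (delta_mx 0 j))).
    by apply: eq_bigr => k _; rewrite !mxE.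
  by rewrite dotg dot_delta mxE eqxx /= eq_sym mulr_natr; case: eqP => // ->.
have r2 : rho ^+ 2 != 0 by rewrite expf_neq0 // gt_eqF.
have gM x : g x *m M^T = rho ^+ 2 *: x.
  apply/rowP => j; rewrite !mxE -dot_delta -dotg.
  by apply: eq_bigr => k _; rewrite !mxE.
have MTM : M^T *m M = (rho ^+ 2)%:M.
  have : (rho ^- 2 *: M) *m M^T = 1%:M.
    by rewrite -scalemxAl MMT scale_scalar_mx mulVf.
  move=> /mulmx1C; rewrite -scalemxAr => /(congr1 (fun X => rho ^+ 2 *: X)).
  by rewrite scalerA mulfV // scale1r scale_scalar_mx mulr1.
exists M => // x; apply/eqP; rewrite -subr_eq -/(g x); apply/eqP.
apply: (scalerI r2); rewrite [RHS]scalemxAl -(gM x) -mulmxA MTM.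
by rewrite -mul_mx_scalar.
Qed.

Lemma similarity_bij : exists2 h : 'rV[R]_d -> 'rV[R]_d,
  similarity rho^-1 h & cancel f h /\ cancel h f.
Proof.
have [M MMT fE] := similarity_affine.
have r2 : rho ^+ 2 != 0 by rewrite expf_neq0 // gt_eqF.
have MN : M *m (rho ^- 2 *: M^T) = 1%:M.
  by rewrite -scalemxAr MMT scale_scalar_mx mulVf.
pose h y := (y - f 0) *m (rho ^- 2 *: M^T).
have fh : cancel f h by move=> x; rewrite /h fE addrK -mulmxA MN mulmx1.
have hf : cancel h f.
  by move=> y; rewrite fE /h -mulmxA (mulmx1C MN) mulmx1 subrK.
exists h => // x y.
have := sim_f (h x) (h y); rewrite !hf => ->.
by rewrite mulKf // gt_eqF.
Qed.

Lemma open_similarity A : open A -> open (f @` A).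
Proof.
move=> /open_euclP oA; apply/open_euclP => _ [x /oA[e e0 eA] <-].
have [h sh [fh hf]] := similarity_bij.
exists (rho * e); first by rewrite mulr_gt0.
move=> y; rewrite /eucl_ball /= => xy; exists (h y); last exact: hf.
apply: eA; rewrite /eucl_ball /= -(ltr_pM2l rho_gt0) -sim_f hf //.
Qed.

Lemma image_setC A : f @` (~` A) = ~` (f @` A).
Proof.
have [h _ [fh hf]] := similarity_bij.
apply/seteqP; split=> [_ [x nAx <-] [y Ay /(can_inj fh) yx]|y nfy].
  by apply: nAx; rewrite -yx.
by exists (h y) => // Ah; apply: nfy; exists (h y).
Qed.

Lemma dist_to_similarity x A : A !=set0 ->
  dist_to (f x) (f @` A) = rho * dist_to x A.
Proof.
move=> A0; have fA0 : f @` A !=set0 by case: A0 => y Ay; exists (f y), y.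
apply/le_anti/andP; split.
  rewrite mulrC -ler_pdivrMr //; apply: dist_to_ge => // y Ay.
  by rewrite ler_pdivrMr // mulrC -sim_f; apply: dist_to_le; exists y.
apply: dist_to_ge => // _ [y Ay <-].
by rewrite sim_f ler_pM2l //; exact: dist_to_le.
Qed.

End Similarity.

(** * Lebesgue outer measure *)

Section LebesgueOuterMeasure.
Context {R : realType} {d : nat}.
Local Notation V := 'rV[R]_d.+1.
Local Notation lambda := (@lebesgue_d R d.+1).
Implicit Types (x a b w : V) (A B : set V).

Definition box_volume a b : R := \prod_(j < d.+1) (b 0 j - a 0 j).

Lemma box_volume_ge0 a b : (forall j, a 0 j <= b 0 j) -> 0 <= box_volume a b.
Proof. by move=> ab; apply: prodr_ge0 => j _; rewrite subr_ge0. Qed.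

Lemma lebesgue_le_cover (a b : nat -> V) A : (forall i j, a i 0 j <= b i 0 j) ->
  A `<=` \bigcup_i box (a i) (b i) ->
  (lambda A <= \sum_(i <oo) (box_volume (a i) (b i))%:E)%E.
Proof. by move=> ab Aab; apply: ereal_inf_lbound; exists (a, b). Qed.

Lemma lebesgue_ge0 A : (0 <= lambda A)%E.
Proof.
apply: le_ereal_inf_tmp => _ [[a b] [/= ab _] <-].
by apply: nneseries_ge0 => i _ _; rewrite lee_fin box_volume_ge0.
Qed.

Lemma lebesgue_le A B : A `<=` B -> (lambda A <= lambda B)%E.
Proof.
move=> AB; apply: le_ereal_inf => _ [[a b] [/= ab Bab] <-].
by exists (a, b) => //; split => //; apply: subset_trans Bab.
Qed.

Lemma lebesgue_box a b : (forall j, a 0 j <= b 0 j) ->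
  (lambda (box a b) <= (box_volume a b)%:E)%E.
Proof.
move=> ab.
pose a' i : V := if i is 0%N then a else 0; pose b' i : V := if i is 0%N then b else 0.
have -> : (box_volume a b)%:E = (\sum_(i <oo) (box_volume (a' i) (b' i))%:E)%E.
  rewrite nneseries_recl //; last first.
    by case=> [|i] _; rewrite lee_fin box_volume_ge0.
  rewrite [X in (_ + X)%E]eseries_cond eseries0 ?adde0 // => -[|i] //= _ _.
  by rewrite /box_volume big_ord_recl /= subrr mul0r.
by apply: lebesgue_le_cover => [[|i] j|x xab]; [exact: ab|by []|exists 0%N].
Qed.

Lemma lebesgue0 : lambda set0 = 0%E.
Proof.
apply/le_anti/andP; split; last exact: lebesgue_ge0.
apply: (@le_trans _ _ (lambda (box 0 0))); first exact: lebesgue_le.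
apply: le_trans (lebesgue_box _) _ => //.
by rewrite /box_volume big_ord_recl /= subrr mul0r.
Qed.

Lemma lebesgue_sigma_subadditive : sigma_subadditive lambda.
Proof.
move=> A; have [[i ioo]|] := pselect (exists i, lambda (A i) = +oo%E).
  rewrite (eseries_pinfty _ _ ioo) ?leey // => n _.
  by rewrite -ltNye (lt_le_trans _ (lebesgue_ge0 _)).
rewrite -forallNE => Aoo.
suff add2e (e : {posnum R}) :
    (lambda (\bigcup_n A n) <= \sum_(i <oo) lambda (A i) + e%:num%:E)%E.
  by apply/lee_addgt0Pr => _/posnumP[].
rewrite (le_trans _ (epsilon_trick _ _ _)) //; last first.
  by move=> n; exact: lebesgue_ge0.
pose P n (ab : (nat -> V) * (nat -> V)) :=
  [/\ forall i j, ab.1 i 0 j <= ab.2 i 0 j,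
      A n `<=` \bigcup_i box (ab.1 i) (ab.2 i) &
      (\sum_(k <oo) (box_volume (ab.1 k) (ab.2 k))%:E <=
        lambda (A n) + (e%:num / (2 ^ n.+1)%:R)%:E)%E].
have [G PG] : {G : nat -> (nat -> V) * (nat -> V) & forall n, P n (G n)}.
  apply: (@choice _ _ P) => n; rewrite /P /lebesgue_d.
  set S := (X in ereal_inf X).
  have S0 : (0 <= ereal_inf S)%E by exact: (lebesgue_ge0 (A n)).
  have en1 : 0 < e%:num / (2 ^ n.+1)%:R :> R by [].
  have fS : ereal_inf S \is a fin_num.
    by rewrite ge0_fin_numE // ltey; apply/eqP; exact: (Aoo n).
  have [_ [ab [ab1 ab2] <-] abS] := lb_ereal_inf_adherent en1 fS.
  by exists ab; split => //; exact: ltW.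
pose vol (p : nat * nat) := (box_volume ((G p.1).1 p.2) ((G p.1).2 p.2))%:E.
have vol0 p : (0 <= vol p)%E.
  by rewrite lee_fin box_volume_ge0 // => j; have [+ _ _] := PG p.1; apply.
apply: (@le_trans _ _ (\sum_(i <oo) \sum_(j <oo) vol (i, j))%E); last first.
  apply: lee_nneseries => n _; last by have [_ _] := PG n.
  by move=> _; apply: nneseries_ge0 => m _ _; exact: vol0.
have /card_esym/ppcard_eqP[f] := card_nat2.
apply: (@le_trans _ _ (\sum_(i <oo) vol (f i))%E).
  apply: lebesgue_le_cover => [i j|x [n _ Anx]].
    by have [+ _ _] := PG (f i).1; apply.
  have [_ /(_ x Anx)[m _ mx] _] := PG n.
  by exists (f^-1%FUN (n, m)) => //=; rewrite invK ?inE.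
rewrite nneseries_esumT; last by move=> n; exact: vol0.
rewrite -(@reindex_esum _ _ _ [set: nat] [set: nat * nat] f vol) //.
rewrite nneseries_esumT; last by move=> n; apply: nneseries_ge0 => m _ _; exact: vol0.
under [leRHS]eq_esum => i _.
  rewrite nneseries_esumT; last by move=> m; exact: vol0.
  over.
rewrite (@esum_esum R nat nat setT (fun=> setT) (fun i j => vol (i, j))) //.
have -> : [set: nat] `*`` (fun=> [set: nat]) = [set: nat * nat].
  by apply/seteqP; split.
by rewrite le_eqVlt; apply/orP; left; apply/eqP; apply: eq_esum => -[].
Qed.

HB.instance Definition _ := isOuterMeasure.Build R V lambda
  lebesgue0 lebesgue_ge0 lebesgue_le lebesgue_sigma_subadditive.

Definition set_coord w k (c : R) : V := \row_j (if j == k then c else w 0 j).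

Lemma set_coordE w k c j : set_coord w k c 0 j = if j == k then c else w 0 j.
Proof. by rewrite mxE. Qed.

Lemma box_volume_split a b k : box_volume a b =
  (b 0 k - a 0 k) * \prod_(j < d.+1 | j != k) (b 0 j - a 0 j).
Proof. by rewrite /box_volume (bigD1 k). Qed.

Lemma box_volume_set_coord a b k s t :
  box_volume (set_coord a k s) (set_coord b k t) =
  (t - s) * \prod_(j < d.+1 | j != k) (b 0 j - a 0 j).
Proof.
rewrite (box_volume_split _ _ k) !set_coordE eqxx; congr (_ * _).
by apply: eq_bigr => j /negbTE jk; rewrite !set_coordE jk.
Qed.

Lemma set_coord_id w k : set_coord w k (w 0 k) = w.
Proof. by apply/rowP => j; rewrite set_coordE; case: eqP => [->|]. Qed.

(** A hyperplane orthogonal to an axis cuts a box into two boxes whose volumes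
    add up. *)
Lemma caratheodory_halfspace k (c : R) :
  caratheodory_measurable lambda [set x : V | x 0 k <= c].
Proof.
apply: le_caratheodory_measurable => X; apply: le_ereal_inf_tmp.
move=> _ [[a b] [/= ab Xab] <-].
pose b1 i := set_coord (b i) k (Num.max (a i 0 k) (Num.min (b i 0 k) c)).
pose a2 i := set_coord (a i) k (Num.min (b i 0 k) (Num.max (a i 0 k) c)).
have ab1 i j : a i 0 j <= b1 i 0 j.
  by rewrite set_coordE; case: eqP => [->|_ //]; rewrite le_max lexx.
have ab2 i j : a2 i 0 j <= b i 0 j.
  by rewrite set_coordE; case: eqP => [->|_ //]; rewrite ge_min lexx.
apply: (@le_trans _ _ (\sum_(i <oo) (box_volume (a i) (b1 i))%:E +
    \sum_(i <oo) (box_volume (a2 i) (b i))%:E)%E).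
  apply: leeD; apply: lebesgue_le_cover => // x [/Xab[i _ xi] /= xc]; exists i => // j.
    have /andP[x1 x2] := xi j; rewrite x1 /= set_coordE; case: eqP => [jk|//].
    by rewrite le_max -jk le_min x2 /= jk xc orbT.
  have /andP[x1 x2] := xi j; rewrite x2 andbT set_coordE; case: eqP => [jk|//].
  have cx : c <= x 0 k by apply/ltW; rewrite ltNge; apply/negP.
  by rewrite ge_min -jk ge_max x1 /= jk cx orbT.
rewrite -nneseriesD; try by move=> i _; rewrite lee_fin box_volume_ge0.
apply: lee_nneseries => i _.
  by move=> _; apply: adde_ge0; rewrite lee_fin box_volume_ge0.
have vol1 : box_volume (a i) (b1 i) = box_volume (set_coord (a i) k (a i 0 k)) (b1 i).
  by rewrite set_coord_id.
have vol2 : box_volume (a2 i) (b i) = box_volume (a2 i) (set_coord (b i) k (b i 0 k)).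
  by rewrite set_coord_id.
rewrite -EFinD lee_fin vol1 vol2 !box_volume_set_coord -mulrDl.
rewrite [leRHS](bigD1 k) //= ler_wpM2r //.
  by apply: prodr_ge0 => j _; rewrite subr_ge0.
have := ab i k; rewrite maxEle minEle minEle maxEle.
by do !case: ifP; lra.
Qed.

Lemma caratheodory_open_halfspace k (c : R) :
  caratheodory_measurable lambda [set x : V | x 0 k < c].
Proof.
have -> : [set x : V | x 0 k < c] =
    \bigcup_(n : nat) [set x : V | x 0 k <= c - n.+1%:R^-1].
  apply/seteqP; split=> [x /= xc|x [n _ /=]]; last first.
    have : 0 < n.+1%:R^-1 :> R by rewrite invr_gt0.
    by set y := _^-1; lra.
  exists (Num.truncn (c - x 0 k)^-1) => //=.
  have cx : 0 < c - x 0 k by rewrite subr_gt0.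
  have : (Num.truncn (c - x 0 k)^-1).+1%:R^-1 < c - x 0 k.
    by rewrite invf_plt ?posrE ?ltr0n // truncnS_gt.
  by set y := _^-1; lra.
by apply: caratheodory_measurable_bigcup => n; exact: caratheodory_halfspace.
Qed.

Lemma caratheodory_open_box a b : caratheodory_measurable lambda
  [set x : V | forall j, a 0 j < x 0 j < b 0 j].
Proof.
suff H (s : seq 'I_d.+1) : caratheodory_measurable lambda
    [set x : V | forall j, j \in s -> a 0 j < x 0 j < b 0 j].
  have := H (enum 'I_d.+1); congr caratheodory_measurable.
  by apply/seteqP; split=> x /= Hx j *; apply: Hx; rewrite mem_enum.
elim: s => [|k s IH].
  have -> : [set x : V | forall j, j \in [::] -> a 0 j < x 0 j < b 0 j] = ~` set0.
    by apply/seteqP; split=> x // _ [].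
  exact/caratheodory_measurable_setC/caratheodory_measurable_set0.
have -> : [set x : V | forall j, j \in k :: s -> a 0 j < x 0 j < b 0 j] =
    (~` [set x : V | x 0 k <= a 0 k] `&` [set x : V | x 0 k < b 0 k]) `&`
    [set x : V | forall j, j \in s -> a 0 j < x 0 j < b 0 j].
  apply/seteqP; split=> x /=.
    move=> Hx; have /andP[x1 x2] := Hx k (mem_head _ _); split; first split=> //.
      by apply/negP; rewrite -ltNge.
    by move=> j js; apply: Hx; rewrite inE js orbT.
  move=> [[/negP + x2] Hx] j; rewrite -ltNge => x1.
  by rewrite inE => /orP[/eqP ->|/Hx //]; rewrite x1.
apply: caratheodory_measurable_setI => //; apply: caratheodory_measurable_setI.
  exact/caratheodory_measurable_setC/caratheodory_halfspace.
exact: caratheodory_open_halfspace.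
Qed.

(** An open set is the union of the open boxes with rational corners that it
    contains, and there are countably many of these. *)
Lemma caratheodory_open A : open A -> caratheodory_measurable lambda A.
Proof.
move=> /open_euclP oA.
pose rbox (p : 'rV[rat]_d.+1 * 'rV[rat]_d.+1) :=
  [set x : V | forall j, ratr (p.1 0 j) < x 0 j < ratr (p.2 0 j)].
pose C n : set V := if (unpickle n : option ('rV[rat]_d.+1 * 'rV[rat]_d.+1)) is Some p
  then (if `[< rbox p `<=` A >] then rbox p else set0) else set0.
have -> : A = \bigcup_n C n.
  apply/seteqP; split=> [x Ax|x [n _]]; last first.
    by rewrite /C; case: unpickle => // p; case: asboolP => // pA /pA.
  have [e e0 eA] := oA x Ax.
  pose s := e / d.+2%:R.
  have s0 : 0 < s by rewrite divr_gt0.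
  have [p1 Hp1] : {p1 : 'I_d.+1 -> rat & forall j, x 0 j - s < ratr (p1 j) < x 0 j}.
    apply: (@choice _ _ (fun j q => x 0 j - s < ratr q < x 0 j)) => j.
    have [|q qx] := @rat_in_itvoo R (x 0 j - s) (x 0 j); first by lra.
    by exists q; move: qx; rewrite in_itv.
  have [p2 Hp2] : {p2 : 'I_d.+1 -> rat & forall j, x 0 j < ratr (p2 j) < x 0 j + s}.
    apply: (@choice _ _ (fun j q => x 0 j < ratr q < x 0 j + s)) => j.
    have [|q qx] := @rat_in_itvoo R (x 0 j) (x 0 j + s); first by lra.
    by exists q; move: qx; rewrite in_itv.
  pose p := (\row_j p1 j, \row_j p2 j) : 'rV[rat]_d.+1 * 'rV[rat]_d.+1.
  exists (pickle p) => //; rewrite /C pickleK asboolT.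
    move=> j /=; rewrite !mxE.
    by have /andP[_ ->] := Hp1 j; have /andP[-> _] := Hp2 j.
  move=> y py; apply: eA; apply: (@le_lt_trans _ _ (d.+1%:R * s)).
    apply: eucl_dist_le_coord => j; have := py j; rewrite /= !mxE.
    have := Hp1 j; have := Hp2 j; rewrite ler_norml.
    by move=> /andP[? ?] /andP[? ?] /andP[? ?]; apply/andP; split; lra.
  by rewrite /s mulrCA gtr_pMr // ltr_pdivrMr // mul1r ltr_nat.
apply: caratheodory_measurable_bigcup => n; rewrite /C.
case: unpickle => [p|]; last exact: caratheodory_measurable_set0.
case: ifP => _; last exact: caratheodory_measurable_set0.
have := @caratheodory_open_box (\row_j ratr (p.1 0 j)) (\row_j ratr (p.2 0 j)).
by congr caratheodory_measurable; apply/seteqP; split=> x Hx j; have := Hx j;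
  rewrite !mxE.
Qed.

End LebesgueOuterMeasure.

(** * Lebesgue measure of linear images *)

Section LinearImages.
Context {R : realType} {d : nat}.
Local Notation V := 'rV[R]_d.+1.
Local Notation lambda := (@lebesgue_d R d.+1).
Implicit Types (x a b w : V) (A B : set V) (f g : V -> V) (c : R).

(** The inequality suffices to be checked on boxes and is stable under
    composition; equality comes back by applying it to the inverse map. *)
Definition scales_volume c f := forall A, (lambda (f @` A) <= c%:E * lambda A)%E.

Lemma scales_volume_box c f : 0 < c ->
  (forall a b, (forall j, a 0 j <= b 0 j) ->
     (lambda (f @` box a b) <= (c * box_volume a b)%:E)%E) ->
  scales_volume c f.
Proof.
move=> c0 fbox A; rewrite -lee_pdivrMl //; apply: le_ereal_inf_tmp.
move=> _ [[a b] [/= ab Aab] <-]; rewrite lee_pdivrMl //.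
apply: (@le_trans _ _ (\sum_(i <oo) lambda (f @` box (a i) (b i)))%E).
  apply: le_trans (lebesgue_sigma_subadditive _).
  by apply: lebesgue_le => _ [x /Aab[i _ xi] <-]; exists i => //; exists x.
rewrite -nneseriesZl //; last by move=> i _; rewrite lee_fin box_volume_ge0.
apply: lee_nneseries => i _; first by move=> _; exact: lebesgue_ge0.
by rewrite -EFinM; apply: fbox.
Qed.

Lemma scales_volume_comp c c' f g : 0 <= c' ->
  scales_volume c f -> scales_volume c' g -> scales_volume (c' * c) (g \o f).
Proof.
move=> c'0 sf sg A; rewrite -image_comp EFinM -muleA.
by apply: le_trans (sg _) _; rewrite lee_wpmul2l // lee_fin.
Qed.

Lemma eq_scales_volume c f g : f =1 g -> scales_volume c f -> scales_volume c g.
Proof. by move=> /funext <-. Qed.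

Lemma scales_volume_coord k (c : R) : c != 0 ->
  scales_volume `|c| (fun w => set_coord w k (c * w 0 k)).
Proof.
move=> c0; apply: scales_volume_box; first by rewrite normr_gt0.
move=> a b ab.
pose lo := Num.min (c * a 0 k) (c * b 0 k).
pose hi := Num.max (c * a 0 k) (c * b 0 k).
have -> : `|c| * box_volume a b = box_volume (set_coord a k lo) (set_coord b k hi).
  rewrite box_volume_set_coord (box_volume_split a b k) mulrA; congr (_ * _).
  rewrite -[b 0 k - a 0 k]ger0_norm ?subr_ge0 // -normrM mulrBr.
  rewrite /hi /lo maxEle minEle; case: ifP => h; first by rewrite ger0_norm ?subr_ge0.
  rewrite distrC ger0_norm // subr_ge0; have := le_total (c * a 0 k) (c * b 0 k).
  by rewrite h.
apply: le_trans (lebesgue_box _); last first.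
  by move=> j; rewrite !set_coordE; case: eqP => // _; rewrite ge_min le_max lexx.
apply: lebesgue_le => _ [x xab <-] j; rewrite !set_coordE; case: eqP => [_|_] //.
have /andP[x1 x2] := xab k; rewrite /lo /hi ge_min le_max.
have [c1|c1] := leP 0 c; first by rewrite (ler_wpM2l c1 x1) (ler_wpM2l c1 x2) orbT.
by rewrite !(ler_nM2l c1) x1 x2 !orbT.
Qed.

(** A shear along the axis [k] displaces a thin slab orthogonal to the axis [i]
    almost rigidly: cutting a box into [m.+1] slabs bounds the volume of its image
    up to an error of order [m.+1 ^-1]. *)
Lemma scales_volume_shear i k (c : R) : i != k ->
  scales_volume 1 (fun w => set_coord w k (w 0 k + c * w 0 i)).
Proof.
move=> ik; apply: scales_volume_box => // a b ab; rewrite mul1r.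
set f := fun w => _.
pose li := b 0 i - a 0 i; pose lk := b 0 k - a 0 k.
pose rest := \prod_(j < d.+1 | (j != i) && (j != k)) (b 0 j - a 0 j).
have li0 : 0 <= li by rewrite subr_ge0.
have lk0 : 0 <= lk by rewrite subr_ge0.
have rest0 : 0 <= rest by apply: prodr_ge0 => j _; rewrite subr_ge0.
have volE a' b' : (forall j, j != i -> j != k -> b' 0 j - a' 0 j = b 0 j - a 0 j) ->
    box_volume a' b' = (b' 0 i - a' 0 i) * ((b' 0 k - a' 0 k) * rest).
  move=> ab'; rewrite /box_volume (bigD1 i) //= (bigD1 k) /= 1?eq_sym //.
  by congr (_ * (_ * _)); apply: eq_bigr => j /andP[ji jk]; apply: ab'.
apply/lee_addgt0Pr => e e0.
pose m := Num.truncn (2 * `|c| * li ^+ 2 * rest / e).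
pose K : R := m.+1%:R; have K0 : 0 < K by rewrite ltr0n.
pose del := li / K; have del0 : 0 <= del by rewrite divr_ge0 // ltW.
pose s (n : nat) := a 0 i + n%:R * del.
pose lo n := set_coord (set_coord a i (s n)) k (a 0 k + c * s n - `|c| * del).
pose hi n := set_coord (set_coord b i (s n.+1)) k (b 0 k + c * s n + `|c| * del).
have sS n : s n.+1 = s n + del by rewrite /s -natr1; ring.
have cdel : 0 <= `|c| * del by rewrite mulr_ge0.
have lohi n j : lo n 0 j <= hi n 0 j.
  rewrite !set_coordE; case: eqP => _; first by have := ab k; lra.
  by case: eqP => _ //; rewrite sS; lra.
have cover : f @` box a b `<=` \big[setU/set0]_(n < m.+1) box (lo n) (hi n).
  move=> _ [x xab <-]; have /andP[x1 x2] := xab i.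
  have [n nm [n1 n2]] : exists2 n, (n < m.+1)%N & s n <= x 0 i /\ x 0 i <= s n.+1.
    have [del1|del1] := eqVneq del 0.
      exists 0%N => //; rewrite sS /s del1 !mulr0 !addr0; split=> //.
      have li1 : li = 0 by move/eqP: del1; rewrite /del mulf_eq0 invr_eq0 (gt_eqF K0) orbF => /eqP.
      by move: x2; rewrite -[b 0 i](subrK (a 0 i)) -/li li1 add0r.
    have del2 : 0 < del by rewrite lt_neqAle eq_sym del1.
    have [xb|xb] := leP (a 0 i + m%:R * del) (x 0 i).
      exists m => //; split=> //; rewrite /s -[_.+1%:R]/K /del mulrCA mulfV ?gt_eqF // mulr1.
      by rewrite /li addrC subrK.
    pose n := Num.truncn ((x 0 i - a 0 i) / del).
    have /andP[n1 n2] : n%:R <= (x 0 i - a 0 i) / del < n.+1%:R.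
      by apply: truncn_itv; rewrite divr_ge0 // subr_ge0.
    rewrite ler_pdivlMr // in n1; rewrite ltr_pdivrMr // in n2.
    exists n; last by rewrite /s; split; lra.
    rewrite ltnS -(ler_nat R) -(ler_pM2r del2); apply: le_trans n1 _; lra.
  rewrite -(bigcup_mkord m.+1 (fun n => box (lo n) (hi n))); exists n => // j.
  have /andP[y1 y2] := xab j.
  rewrite /f !set_coordE; case: eqP => [jk|_].
    have : `|c * (x 0 i - s n)| <= `|c| * del.
      rewrite normrM ler_wpM2l // ger0_norm ?subr_ge0 //.
      by move: n2; rewrite sS; lra.
    rewrite ler_norml => /andP[z1 z2]; have /andP[w1 w2] := xab k.
    by apply/andP; split; lra.
  by case: eqP => [ji|_]; [rewrite ji n1 n2|rewrite y1 y2].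
apply: le_trans (lebesgue_le cover) _.
apply: le_trans (@outer_measure_subadditive _ _ lambda (fun n => box (lo n) (hi n)) m.+1) _.
have volI n : box_volume (lo n) (hi n) = del * ((lk + 2 * (`|c| * del)) * rest).
  rewrite (volE (lo n) (hi n)).
    by rewrite !set_coordE eqxx (negbTE ik) eqxx sS; congr (_ * (_ * _)); rewrite /lk; ring.
  by move=> j /negbTE ji /negbTE jk; rewrite !set_coordE ji jk.
apply: (@le_trans _ _ (\sum_(n < m.+1) (del * ((lk + 2 * (`|c| * del)) * rest))%:E)%E).
  by apply: lee_sum => n _; rewrite -(volI n); exact: lebesgue_box.
rewrite sumEFin lee_fin sumr_const card_ord -[leLHS]mulr_natl -/K.
have -> : K * (del * ((lk + 2 * (`|c| * del)) * rest)) =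
    li * (lk * rest) + 2 * `|c| * li ^+ 2 * rest / K.
  by rewrite /del; field; rewrite gt_eqF.
rewrite (volE a b) // lerD2l ler_pdivrMr // [leRHS]mulrC -ler_pdivrMr //.
by apply: ltW; exact: truncnS_gt.
Qed.

Lemma scales_volume_translation w : scales_volume 1 (fun x => x + w).
Proof.
apply: scales_volume_box => // a b ab; rewrite mul1r.
have -> : box_volume a b = box_volume (a + w) (b + w).
  by apply: eq_bigr => j _; rewrite !mxE; ring.
apply: le_trans (lebesgue_box _); last by move=> j; rewrite !mxE lerD2r.
by apply: lebesgue_le => _ [x xab <-] j; rewrite !mxE !lerD2r.
Qed.

Lemma scales_volume_perm (s : {perm 'I_d.+1}) :
  scales_volume 1 (fun x => \row_j x 0 (s j)).
Proof.
apply: scales_volume_box => // a b ab; rewrite mul1r.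
have -> : box_volume a b = box_volume (\row_j a 0 (s j)) (\row_j b 0 (s j)).
  rewrite /box_volume (reindex_inj (@perm_inj _ s)) /=.
  by apply: eq_bigr => j _; rewrite !mxE.
apply: le_trans (lebesgue_box _); last by move=> j; rewrite !mxE.
by apply: lebesgue_le => _ [x xab <-] j; rewrite !mxE.
Qed.

Lemma scales_volume_combination k (u : 'I_d.+1 -> R) : u k != 0 ->
  scales_volume `|u k| (fun w => set_coord w k (\sum_i w 0 i * u i)).
Proof.
move=> uk.
suff H (t : seq 'I_d.+1) : k \notin t -> scales_volume `|u k|
    (fun w => set_coord w k (w 0 k * u k + \sum_(i <- t) w 0 i * u i)).
  have := H [seq i <- enum 'I_d.+1 | i != k].
  rewrite mem_filter eqxx => /(_ isT); apply: eq_scales_volume => w.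
  rewrite [in RHS](bigD1 k) //=; congr (set_coord w k (_ + _)).
  by rewrite big_filter big_enum_cond.
elim: t => [_|i t IH].
  apply: (eq_scales_volume _ (scales_volume_coord k uk)) => w.
  by rewrite big_nil addr0 mulrC.
rewrite inE negb_or eq_sym => /andP[ik kt].
have := scales_volume_comp ler01 (IH kt) (scales_volume_shear (u i) ik).
rewrite mul1r; apply: eq_scales_volume => w /=.
apply/rowP => j; rewrite !set_coordE eqxx (negbTE ik) big_cons.
by case: eqP => // _; ring.
Qed.

(** A triangular map can be carried out in place, one coordinate at a time, in an
    order in which each coordinate is overwritten when it is no longer needed. *)
Lemma scales_volume_triangular (M : 'M[R]_d.+1) (s : seq 'I_d.+1) :
  pairwise (fun i j => M i j == 0) s -> uniq s -> (forall j, M j j != 0) ->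
  scales_volume (\prod_(j <- s) `|M j j|)
    (fun x => \row_j (if j \in s then (x *m M) 0 j else x 0 j)).
Proof.
move=> + + Mjj; elim/last_ind: s => [_ _|s k IH].
  rewrite big_nil; have := scales_volume_translation 0.
  by apply: eq_scales_volume => x; apply/rowP => j; rewrite !mxE addr0.
rewrite pairwise_rcons rcons_uniq => /andP[sk ps] /andP[ks us].
rewrite -cats1 big_cat big_seq1 /= mulrC.
have := scales_volume_comp (normr_ge0 _) (IH ps us)
  (scales_volume_combination (u := fun i => M i k) (Mjj k)).
apply: eq_scales_volume => x; apply/rowP => j.
rewrite /= set_coordE !mxE mem_cat inE orbC; case: eqP => [->|_] //=.
apply: eq_bigr => i _; rewrite !mxE; case: ifP => // si.
by move/allP: sk => /(_ _ si)/eqP ->; rewrite !mulr0.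
Qed.

(** The factorization of [M] into a permutation matrix, a unit lower triangular
    matrix and an upper triangular one reduces the claim to triangular maps. *)
Lemma scales_volume_mulmx (M : 'M[R]_d.+1) : M \in unitmx ->
  scales_volume `|\det M| (fun x => x *m M).
Proof.
move=> uM.
have := cormen_lup_correct M; have := cormen_lup_perm M.
have := cormen_lup_detL M; have := @cormen_lup_lower _ _ M.
have := @cormen_lup_upper _ _ M.
case: (cormen_lup M) => [[P L] U] /= Uup Llo detL /is_perm_mxP[s ->].
rewrite -!mulmxE => PM.
have MLU : M = perm_mx s^-1%g *m L *m U.
  by rewrite -mulmxA -PM mulmxA -perm_mxM mulVg perm_mx1 mul1mx.
have detU : `|\det M| = `|\det U|.
  by rewrite MLU !det_mulmx detL mulr1 det_perm normrM normrX normrN1 expr1n mul1r.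
have trU : \det U = \prod_j U j j.
  rewrite -det_tr det_trig; first by apply: eq_bigr => j _; rewrite mxE.
  by apply/is_trig_mxP => i j ij; rewrite mxE Uup.
have Ujj j : U j j != 0.
  have : \det U != 0.
    by rewrite -normr_eq0 -detU normr_eq0 -unitfE -unitmxE.
  by rewrite trU => /prodf_neq0; apply.
have pL : pairwise (fun i j => L i j == 0) (enum 'I_d.+1).
  have : pairwise ltn (map val (enum 'I_d.+1)) by rewrite val_enum_ord -sorted_pairwise ?iota_ltn_sorted //; exact: ltn_trans.
  rewrite pairwise_map; apply: sub_pairwise => i j /= ij.
  by rewrite Llo 1?ltnW // -(inj_eq val_inj) /= (ltn_eqF ij).
pose rs := [seq rev_ord i | i <- enum 'I_d.+1].
have urs : uniq rs by rewrite map_inj_uniq ?enum_uniq //; exact: rev_ord_inj.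
have mrs j : j \in rs by apply/mapP; exists (rev_ord j); rewrite ?mem_enum ?rev_ordK.
have pU : pairwise (fun i j => U i j == 0) rs.
  have : pairwise ltn (map val (enum 'I_d.+1)) by rewrite val_enum_ord -sorted_pairwise ?iota_ltn_sorted //; exact: ltn_trans.
  rewrite !pairwise_map; apply: sub_pairwise => i j /= ij; rewrite Uup //=.
  by rewrite !subSS ltn_sub2l // (leq_trans ij) // -ltnS ltn_ord.
have sP := scales_volume_perm s.
have sL := scales_volume_triangular pL (enum_uniq _) _.
have sU := scales_volume_triangular pU urs Ujj.
have {}sL : scales_volume 1 (fun x => x *m L).
  have := sL _; rewrite big1 => [H|j _]; last by rewrite Llo // eqxx normr1.
  apply: (eq_scales_volume _ (H _)) => [x|j]; last by rewrite Llo // eqxx oner_neq0.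
  by apply/rowP => j; rewrite mxE mem_enum.
have {}sU : scales_volume `|\det M| (fun x => x *m U).
  have -> : `|\det M| = \prod_(j <- rs) `|U j j|.
    rewrite detU trU normr_prod -big_enum /=; apply: perm_big.
    by apply: uniq_perm => [||j]; rewrite ?enum_uniq // mem_enum mrs.
  apply: (eq_scales_volume _ sU) => x.
  by apply/rowP => j; rewrite mxE mrs.
have := scales_volume_comp (normr_ge0 _) (scales_volume_comp ler01 sP sL) sU.
rewrite !mulr1; apply: eq_scales_volume => x /=.
rewrite MLU !mulmxA; congr (_ *m _ *m _).
apply/rowP => j; rewrite !mxE (bigD1 (s j)) //= !mxE permK eqxx mulr1 big1 ?addr0 //.
move=> i /negbTE ij; rewrite !mxE; case: eqP => [E|_]; last by rewrite mulr0.
by rewrite -E permKV eqxx in ij.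
Qed.

Lemma scales_volume_similarity rho f : 0 < rho -> similarity rho f ->
  scales_volume (rho ^+ d.+1) f.
Proof.
move=> rho0 sf; have [M MMT fE] := similarity_affine rho0 sf.
have detM : \det M ^+ 2 = (rho ^+ d.+1) ^+ 2.
  by have := congr1 determinant MMT; rewrite det_mulmx det_tr det_scalar -exprM mulnC exprM expr2.
have -> : rho ^+ d.+1 = `|\det M|.
  apply/eqP; rewrite -(eqrXn2 (n := 2)) ?normr_ge0 ?exprn_ge0 // ?ltW //.
  by rewrite real_normK ?num_real // detM.
have uM : M \in unitmx.
  by rewrite unitmxE unitfE -sqrf_eq0 detM !expf_eq0 /= gt_eqF.
have := scales_volume_comp ler01 (scales_volume_mulmx uM) (scales_volume_translation (f 0)).
by rewrite mul1r; apply: eq_scales_volume => x /=; rewrite (fE x).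
Qed.

Lemma lebesgue_similarity rho f A : 0 < rho -> similarity rho f ->
  lambda (f @` A) = ((rho ^+ d.+1)%:E * lambda A)%E.
Proof.
move=> rho0 sf; apply/le_anti/andP; split; first exact: scales_volume_similarity.
have [h sh [fh hf]] := similarity_bij rho0 sf.
have rV0 : 0 < rho^-1 by rewrite invr_gt0.
have := scales_volume_similarity rV0 sh (f @` A).
rewrite image_comp (_ : h \o f = id) ?image_id; last by apply/funext => x; exact: fh.
by rewrite exprVn -lee_pdivrMl ?invr_gt0 ?exprn_gt0 // invrK.
Qed.

End LinearImages.

(** * Size of boxes and bounded open sets *)

Lemma lebesgue_measure_segment {R : realType} (x y : R) : x <= y ->
  lebesgue_measure `[x, y]%classic = (y - x)%:E.
Proof.
move=> xy; rewrite lebesgue_measure_itv /= lte_fin; case: ltP => // yx.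
have -> : y = x by apply/le_anti/andP; split.
by rewrite subrr.
Qed.

(** Integrating in the last variable the inequality for the slices shows, by
    induction on the dimension, that countably many boxes covering the unit cube
    have total volume at least one. The selection [P] records the boxes that meet
    the slice. *)
Lemma unit_cube_cover_volume {R : realType} n (a b : nat -> nat -> R)
    (P : nat -> bool) :
  (forall i j, a i j <= b i j) ->
  (forall x : nat -> R, (forall j, (j < n)%N -> 0 <= x j <= 1) ->
     exists2 i, P i & forall j, (j < n)%N -> a i j <= x j <= b i j) ->
  (1 <= \sum_(i <oo) (if P i then \prod_(0 <= j < n) (b i j - a i j) else 0)%:E)%E.
Proof.
move=> ab; elim: n P => [|n IH] P cov.
  have [//|i Pi _] := cov (fun=> 0).
  have ge0 k : (0%R <= k)%N -> true -> (0 <= (if P k then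
      \prod_(0 <= j < 0) (b k j - a k j) else 0)%:E)%E.
    by move=> _ _; rewrite lee_fin big_geq //; case: ifP.
  apply: le_trans (nneseries_lim_ge i.+1 ge0).
  rewrite big_nat_recr //= Pi [X in (_ + X%:E)%E]big_geq //.
  by rewrite leeDr //; apply: sume_ge0 => k _; rewrite lee_fin big_geq //; case: ifP.
pose w i := if P i then \prod_(0 <= j < n) (b i j - a i j) else 0.
have w0 i : 0 <= w i.
  rewrite /w; case: ifP => // _; rewrite big_mkord; apply: prodr_ge0 => j _.
  by rewrite subr_ge0.
pose I i : set (measurableTypeR R) := `[a i n, b i n]%classic.
pose D : set (measurableTypeR R) := `[0, 1]%classic.
pose F i (x : measurableTypeR R) : \bar R := ((w i)%:E * (\1_(I i) x)%:E)%E.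
have slice x : D x -> (1 <= \sum_(i <oo) F i x)%E.
  rewrite /D /= in_itv /= => x01.
  have := IH (fun i => P i && (a i n <= x <= b i n)) => /(_ _).
  have cov' : forall y : nat -> R, (forall j, (j < n)%N -> 0 <= y j <= 1) ->
      exists2 i, P i && (a i n <= x <= b i n) &
        forall j, (j < n)%N -> a i j <= y j <= b i j.
    move=> y y01.
    have [j jn|i Pi Hi] := cov (fun j => if j == n then x else y j).
      by case: eqP => [//|/eqP jn']; apply: y01; rewrite ltn_neqAle jn' -ltnS.
    exists i; first by rewrite Pi; have := Hi n (ltnSn n); rewrite eqxx.
    by move=> j jn; have := Hi j (ltnW jn); rewrite (ltn_eqF jn).
  move=> /(_ cov') /le_trans; apply; apply: lee_nneseries => i _.
    move=> _; rewrite lee_fin; case: ifP => // _; rewrite big_mkord.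
    by apply: prodr_ge0 => j _; rewrite subr_ge0.
  rewrite /F -EFinM lee_fin indicE /w mem_setE /I in_itv /=.
  by case: (P i) => /=; [case: ifP => _; rewrite ?mulr1 ?mulr0|rewrite mul0r].
have mI i : measurable (I i) by exact: measurable_itv.
have mD : measurable D by exact: measurable_itv.
have mF i : measurable_fun D (F i).
  apply: emeasurable_funM; first exact: measurable_cst.
  by apply/measurable_EFinP; exact: measurable_indic.
have F0 i x : D x -> (0 <= F i x)%E.
  by move=> _; apply: mule_ge0; rewrite lee_fin ?w0 ?indicE.
have one : (\int[lebesgue_measure]_(x in D) 1 = 1 :> \bar R)%E.
  rewrite integral_cst // mul1e -[RHS]/(1%:E) -[X in X%:E]subr0.
  exact: lebesgue_measure_segment.
rewrite -{1}one.
apply: (@le_trans _ _ (\int[lebesgue_measure]_(x in D) \sum_(i <oo) F i x)%E).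
  apply: ge0_le_integral => //.
  under eq_fun do rewrite eseries_cond.
  by apply: ge0_emeasurable_sum => *; [exact: F0|exact: mF].
rewrite integral_nneseries //; apply: lee_nneseries => i _.
  by move=> _; apply: integral_ge0 => x; exact: F0.
rewrite ge0_integralZl_EFin //; last first.
  by apply/measurable_EFinP; exact: measurable_indic.
rewrite integral_indic //.
have -> : (if P i then \prod_(0 <= j < n.+1) (b i j - a i j) else 0)%:E =
    ((w i)%:E * (b i n - a i n)%:E)%E.
  rewrite -EFinM /w; case: ifP => _; last by rewrite mul0r.
  by rewrite big_nat_recr.
rewrite lee_wpmul2l ?lee_fin //.
apply: (@le_trans _ _ (lebesgue_measure (I i))).
  by apply: le_measure; rewrite ?inE //; exact: measurableI.
by rewrite le_eqVlt; apply/orP; left; apply/eqP; exact: lebesgue_measure_segment.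
Qed.

Lemma caratheodory_nondecreasing_cvg {R : realType} {T : pointedType}
    (mu : {outer_measure set T -> \bar R}) (A : nat -> set T) :
  (forall n, caratheodory_measurable mu (A n)) ->
  {homo A : n m / (n <= m)%N >-> (n <= m)%O} ->
  mu (A n) @[n --> \oo] --> mu (\bigcup_n A n).
Proof.
move=> mA hA.
apply: (@nondecreasing_cvg_mu _ (caratheodory_type mu) R
  (mu : set (caratheodory_type mu) -> \bar R) A) => //.
exact: caratheodory_measurable_bigcup.
Qed.

Section SizeOfSets.
Context {R : realType} {d : nat}.
Local Notation V := 'rV[R]_d.+1.
Local Notation lambda := (@lebesgue_d R d.+1).
Implicit Types (x a b w : V) (A B : set V).

Lemma lebesgue_unit_cube : (1 <= lambda (box 0 (const_mx 1%R)))%E.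
Proof.
apply: le_ereal_inf_tmp => _ [[a b] [/= ab cov] <-].
pose a' i j := a i 0 (inord j); pose b' i j := b i 0 (inord j).
have := @unit_cube_cover_volume R d.+1 a' b' xpredT (fun i j => ab i _) => /(_ _).
rewrite /= => H; have {H} := H _.
under eq_eseriesr => i _.
  rewrite big_mkord; under eq_bigr => j _ do rewrite /a' /b' inord_val.
  over.
apply => x x01.
have [j|i _ xi] := cov (\row_j x j).
  by rewrite !mxE x01 ?ltn_ord.
by exists i => // j jd; have := xi (inord j); rewrite mxE inordK.
Qed.

Lemma similarity_dilation (s : R) w : 0 < s -> similarity s (fun x : V => s *: x + w).
Proof.
move=> s0 x y; rewrite /eucl_dist -[s in RHS](gtr0_norm s0) -sqrtr_sqr -sqrtrM ?sqr_ge0 //.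
congr Num.sqrt; rewrite mulr_sumr; apply: eq_bigr => j _; rewrite !mxE.
by rewrite opprD addrACA subrr addr0 -mulrBr exprMn.
Qed.

Lemma lebesgue_open_gt0 A : open A -> A !=set0 -> (0 < lambda A)%E.
Proof.
move=> /open_euclP oA [w Aw]; have [e e0 eA] := oA w Aw.
pose s := e / d.+2%:R; have s0 : 0 < s by rewrite divr_gt0.
pose f (x : V) := s *: x + w.
have fA : f @` box 0 (const_mx 1%R) `<=` A.
  move=> _ [x x01 <-]; apply: eA; apply: (@le_lt_trans _ _ (d.+1%:R * s)).
    apply: eucl_dist_le_coord => j; rewrite /f !mxE distrC addrK normrM (gtr0_norm s0).
    have := x01 j; rewrite !mxE => /andP[x0 x1].
    by rewrite ger0_norm // ger_pMr.
  by rewrite /s mulrCA gtr_pMr // ltr_pdivrMr // mul1r ltr_nat.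
apply: lt_le_trans (lebesgue_le fA).
rewrite (lebesgue_similarity _ s0); last exact: similarity_dilation.
rewrite mule_gt0 // ?lte_fin ?exprn_gt0 //.
by apply: lt_le_trans lebesgue_unit_cube.
Qed.

Lemma lebesgue_bounded_lt_oo A (M : R) : (forall x, A x -> eucl_dist 0 x <= M) ->
  (lambda A < +oo)%E.
Proof.
move=> AM.
have AB : A `<=` box (const_mx (- `|M|)) (const_mx `|M|).
  move=> x /AM xM j; rewrite !mxE -ler_norml.
  have := coord_le_eucl_dist 0 x j; rewrite mxE sub0r normrN.
  by have := ler_norm M; lra.
apply: le_lt_trans (lebesgue_le AB) _; apply: le_lt_trans (lebesgue_box _) (ltry _).
by move=> j; rewrite !mxE; have := normr_ge0 M; lra.
Qed.

Lemma lebesgue_open_nondecreasing_cvg (A : nat -> set V) :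
  (forall n, open (A n)) -> {homo A : n m / (n <= m)%N >-> (n <= m)%O} ->
  lambda (A n) @[n --> \oo] --> lambda (\bigcup_n A n).
Proof.
move=> oA hA; apply: (@caratheodory_nondecreasing_cvg R V lambda) => // n.
exact: caratheodory_open.
Qed.

Lemma lebesgue_disjoint_open (n : nat) (U : 'I_n -> set V) A X :
  open A -> (forall i, open (U i)) -> (forall i, A `&` U i = set0) ->
  (forall i j, i != j -> U i `&` U j = set0) ->
  X `<=` A `|` \bigcup_i U i ->
  lambda X = (lambda (X `&` A) + \sum_(i < n) lambda (X `&` U i))%E.
Proof.
move=> oA oU AU UU XU.
pose B k : set V := if k is k'.+1 then
  (if insub k' : option 'I_n is Some i then U i else set0) else A.
have mB k : caratheodory_measurable lambda (B k).
  case: k => [|k] /=; first exact: caratheodory_open.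
  case: insubP => [i _ _|_]; first exact: caratheodory_open.
  exact: caratheodory_measurable_set0.
have tB : trivIset [set: nat] B.
  apply/trivIsetP => i j _ _; wlog ij : i j / (i < j)%N.
    move=> H ij; have := ij; rewrite neq_ltn => /orP[/H|/H]; first exact.
    by rewrite setIC; apply; rewrite eq_sym.
  case: j ij => // j; case: i => [|i] ij ne /=.
    by case: insubP => [k _ _|_]; [exact: AU|rewrite setI0].
  case: insubP => [k _ ki|_]; last by rewrite set0I.
  case: insubP => [l _ lj|_]; last by rewrite setI0.
  by apply: UU; apply: contraNneq ne => kl; rewrite -ki -lj kl.
have := caratheodory_additive mB tB n.+1 X.
have -> : \big[setU/set0]_(i < n.+1) B i = A `|` \bigcup_i U i.
  rewrite big_ord_recl /=; congr (_ `|` _); apply/seteqP; split=> x.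
    by rewrite -(bigcup_mkord n (fun k => B k.+1)) => -[k /= kn];
      rewrite insubT => Ux; eexists; [|exact: Ux].
  move=> [i _ Ux]; rewrite -(bigcup_mkord n (fun k => B k.+1)); exists i => //=.
  by rewrite valK.
rewrite setIidl // => ->; rewrite big_ord_recl; congr (_ + _)%E.
by apply: eq_bigr => i _; rewrite /= valK.
Qed.

End SizeOfSets.

(** * Inner tubes *)

Section InnerTubes.
Context {R : realType} {d : nat}.
Local Notation V := 'rV[R]_d.+1.
Local Notation lambda := (@lebesgue_d R d.+1).
Implicit Types (x y : V) (A U T : set V) (e g : R).

Definition inner_shell A e : set V := [set x | A x /\ dist_to x (~` A) <= e].

Lemma inner_tubeE A e : inner_tube A e = lambda (inner_shell A e).
Proof. by []. Qed.

Lemma inner_tube_le A e e' : e <= e' -> (inner_tube A e <= inner_tube A e')%E.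
Proof.
by move=> ee'; apply: lebesgue_le => x [Ax /le_trans xe]; split=> //; exact: xe.
Qed.

Lemma inner_tube_full A e : (forall x, A x -> dist_to x (~` A) <= e) ->
  inner_tube A e = lambda A.
Proof.
move=> Ae; rewrite inner_tubeE; congr lambda; apply/seteqP.
by split=> [x []|x Ax] //; split=> //; exact: Ae.
Qed.

Lemma inner_shell_clopen U T e : open U -> open (T `\` U) -> U `<=` T ->
  ~` T !=set0 -> inner_shell T e `&` U = inner_shell U e.
Proof.
move=> oU oTU UT T0; apply/seteqP; split=> x.
  by move=> [[Tx xe] Ux]; split=> //; rewrite -(dist_to_clopen_part oU oTU).
move=> [Ux xe]; split=> //; split; first exact: UT.
by rewrite (dist_to_clopen_part oU oTU).
Qed.

Lemma inner_tube_similarity rho f A e : 0 < rho -> similarity rho f ->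
  ~` A !=set0 ->
  inner_tube (f @` A) e = ((rho ^+ d.+1)%:E * inner_tube A (e / rho))%E.
Proof.
move=> rho0 sf A0; rewrite !inner_tubeE -(lebesgue_similarity _ rho0 sf).
have [h _ [fh hf]] := similarity_bij rho0 sf.
congr lambda; apply/seteqP; split.
  move=> _ [[x Ax <-] xe]; exists x => //; split=> //.
  by rewrite ler_pdivlMr // mulrC -(dist_to_similarity rho0 sf) // (image_setC rho0 sf).
move=> _ [x [Ax xe] <-]; split; first by exists x.
by rewrite -(image_setC rho0 sf) (dist_to_similarity rho0 sf) // mulrC -ler_pdivlMr.
Qed.

Lemma bounded_set_eucl A : bounded_set A ->
  exists M, forall x, A x -> eucl_dist 0 x <= M.
Proof.
move=> bA; have [M _ HM] := pinfty_ex_gt0 bA.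
exists (d.+1%:R * M) => x /HM xM; apply: eucl_dist_le_coord => j.
rewrite mxE sub0r normrN; apply: le_trans xM.
have -> : `|x| = \big[Num.max/0]_ij `|x ij.1 ij.2| by exact: mx_normrE.
exact: (le_bigmax _ (fun ij => `|x ij.1 ij.2|) (0, j)).
Qed.

Lemma bounded_setC_neq0 A M : (forall x, A x -> eucl_dist 0 x <= M) ->
  ~` A !=set0.
Proof.
move=> AM; exists (const_mx (`|M| + 1)) => /AM.
have := coord_le_eucl_dist 0 (const_mx (`|M| + 1)) (@ord0 d).
rewrite !mxE sub0r normrN ger0_norm ?addr_ge0 //.
by have := ler_norm M; lra.
Qed.

(** The points of an open set [A] at distance more than [n.+1 ^-1] from the
    complement exhaust [A], so that the volume of the tubes tends to zero. *)
Lemma inner_tube_cvg0 A g (q : {poly R}) : open A -> ~` A !=set0 ->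
  (lambda A < +oo)%E -> 0 < g ->
  (forall e, 0 < e <= g -> inner_tube A e = (q.[e])%:E) -> q.[0] = 0.
Proof.
move=> oA A0 Afin g0 Aq.
have fA : lambda A \is a fin_num by rewrite ge0_fin_numE // lebesgue_ge0.
pose B n : set V := [set x | A x /\ n.+1%:R^-1 < dist_to x (~` A)].
have oB n : open (B n) by exact: open_dist_to_gt.
have BA : \bigcup_n B n = A.
  apply/seteqP; split=> [x [n _ []]//|x Ax].
  have x0 := dist_to_gt0 oA A0 Ax.
  exists (Num.truncn (dist_to x (~` A))^-1) => //; split=> //.
  by rewrite invf_plt ?posrE ?ltr0n // truncnS_gt.
have hB : {homo B : n m / (n <= m)%N >-> (n <= m)%O}.
  move=> n m nm; apply/subsetPset => x [Ax xn]; split=> //.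
  by apply: le_lt_trans xn; rewrite lef_pV2 ?posrE ?ltr0n // ler_nat ltnS.
have := lebesgue_open_nondecreasing_cvg oB hB; rewrite BA -(fineK fA).
move=> /fine_cvgP[_ cB].
have cq : fine (lambda A) - q.[n.+1%:R^-1] @[n --> \oo] -->
    fine (lambda A) - q.[0].
  apply: cvgB; first exact: cvg_cst.
  apply: (@cvg_comp _ _ _ harmonic (horner q)); first exact: cvg_harmonic.
  exact: continuous_horner.
have E : \forall n \near \oo,
    fine (lambda A) - q.[n.+1%:R^-1] = (fine \o (fun n => lambda (B n))) n.
  exists (Num.truncn g^-1) => // n /= gn.
  have gn' : 0 < (n.+1%:R^-1 : R) <= g.
    rewrite invr_gt0 ltr0n /= invf_ple ?posrE ?ltr0n //; apply: ltW.
    by apply: lt_le_trans (truncnS_gt _) _; rewrite ler_nat.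
  have := caratheodory_open (oB n) A.
  have -> : A `&` B n = B n by apply/seteqP; split=> x [] // Ax ?; split.
  have -> : A `&` ~` B n = inner_shell A n.+1%:R^-1.
    apply/seteqP; split=> x [Ax xB]; split=> //; last by move=> [_]; rewrite ltNge xB.
    by rewrite leNgt; apply/negP => xn; apply: xB.
  rewrite -inner_tubeE Aq // -(fineK fA).
  by case: (lambda (B n)) => [s [->]|//|//]; rewrite /= addrK.
have cB' : fine (lambda A) - q.[n.+1%:R^-1] @[n --> \oo] --> fine (lambda A).
  apply: cvg_trans cB; apply: near_eq_cvg.
  by apply: filterS E => n ->.
have E0 : fine (lambda A) = fine (lambda A) - q.[0].
  exact: (cvg_unique (@norm_hausdorff _ _) cB' cq).
by move/eqP: E0; rewrite eq_sym addrC -subr_eq0 addrK oppr_eq0 => /eqP.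
Qed.

End InnerTubes.

(** * The tiling and its tube equation *)

Section TilingTube.
Context {R : realType} {d N : nat}.
Local Notation V := 'rV[R]_d.+1.
Local Notation lambda := (@lebesgue_d R d.+1).
Variables (r : 'I_N -> R) (Phi : 'I_N -> V -> V).
Hypothesis N_gt0 : (0 < N)%N.
Hypothesis r_itv : forall n, 0 < r n < 1.
Hypothesis Phi_sim : forall n, similarity (r n) (Phi n).
Variables (O G : set V) (g : R) (kappa : 'I_d.+2 -> R).
Hypothesis O_feasible : feasible Phi O.
Hypothesis G_single : single_generator Phi O G.
Hypothesis G_mono : monophase G g kappa.
Implicit Types (x y : V) (w : seq 'I_N) (e : R).

Let T : set V := \bigcup_(A in tiling Phi O) A.

Let r_gt0 n : 0 < r n. Proof. by case/andP: (r_itv n). Qed.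
Let r_lt1 n : r n < 1. Proof. by case/andP: (r_itv n). Qed.
Let G_open : open G. Proof. by case: G_mono. Qed.

Lemma tilesP y : T y <-> exists w x, G x /\ y = word_map Phi w x.
Proof.
have [gapG cG [x0 Gx0]] := G_single.
have genG : generators Phi O = [set G].
  apply/seteqP; split=> A; rewrite /generators gapG.
    by move=> [x Gx <-]; rewrite /= connected_component_id.
  by move=> ->; exists x0 => //; rewrite connected_component_id.
split=> [[_ [w [G' [+ ->]]] [x + <-]]|[w [x [Gx ->]]]].
  by rewrite genG => -> Gx; exists w, x.
exists (word_map Phi w @` G); last by exists x.
by exists w, G; split=> //; rewrite genG.
Qed.

Lemma tiles_decomposition : T = G `|` \bigcup_n (Phi n @` T).
Proof.
apply/seteqP; split=> y.
  move=> /tilesP[[|n w] [x [Gx ->]]]; first by left.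
  right; exists n => //; exists (word_map Phi w x) => //.
  by apply/tilesP; exists w, x.
move=> [Gy|[n _ [z /tilesP[w [x [Gx ->]]] <-]]].
  by apply/tilesP; exists [::], y.
by apply/tilesP; exists (n :: w), x.
Qed.

Lemma tiles_subset : T `<=` O.
Proof.
have [gapG _ _] := G_single; have [_ _ PhiO _] := O_feasible.
move=> _ /tilesP[w [x [Gx ->]]]; elim: w => [|n w IH] /=.
  by move: Gx; rewrite -gapG => -[].
by apply: (PhiO n); exists (word_map Phi w x).
Qed.

Lemma tiles_disjoint m n : m != n -> (Phi m @` T) `&` (Phi n @` T) = set0.
Proof.
have [_ _ _ disj] := O_feasible => mn.
apply/seteqP; split=> // y [[x Tx xy] [x' Tx' x'y]].
rewrite -(disj m n mn); split; first by exists x => //; exact: tiles_subset.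
by exists x' => //; exact: tiles_subset.
Qed.

Lemma generator_disjoint n : G `&` (Phi n @` T) = set0.
Proof.
have [gapG _ _] := G_single.
apply/seteqP; split=> // y [+ [x Tx xy]]; rewrite -gapG => -[_]; apply.
by exists n => //; exists x => //; apply/subset_closure/tiles_subset.
Qed.

Lemma tiles_open : open T.
Proof.
have -> : T = \bigcup_w (word_map Phi w @` G).
  apply/seteqP; split=> y; first by move=> /tilesP[w [x [Gx ->]]]; exists w => //; exists x.
  by move=> [w _ [x Gx <-]]; apply/tilesP; exists w, x.
apply: bigcup_open => w _; elim: w => [|n w IH] /=; first by rewrite image_id.
by rewrite -image_comp; apply: open_similarity (Phi_sim n) _ IH.
Qed.

Lemma tile_open n : open (Phi n @` T).
Proof. exact: open_similarity (Phi_sim n) _ tiles_open. Qed.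

(** The bound [M] is chosen such that every [Phi n] maps the ball of radius [M]
    around the origin into itself. *)
Lemma tiles_bounded : exists M, forall x, T x -> eucl_dist 0 x <= M.
Proof.
have [_ bG _ _] := G_mono; have [M0 HM0] := bounded_set_eucl bG.
have b_ge0 n : 0 <= eucl_dist 0 (Phi n 0) / (1 - r n).
  by rewrite divr_ge0 ?eucl_dist_ge0 // subr_ge0 ltW.
pose M := `|M0| + \sum_n eucl_dist 0 (Phi n 0) / (1 - r n).
have bM n : eucl_dist 0 (Phi n 0) <= (1 - r n) * M.
  have r1 : 0 < 1 - r n by rewrite subr_gt0.
  rewrite -ler_pdivrMl // mulrC /M (bigD1 n) //= addrCA lerDl.
  by rewrite addr_ge0 //; apply: sumr_ge0 => k _.
exists M => _ /tilesP[w [x [Gx ->]]]; elim: w => [|n w IH] /=.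
  apply: le_trans (HM0 x Gx) _; apply: le_trans (ler_norm _) _.
  by rewrite lerDl; apply: sumr_ge0.
apply: le_trans (eucl_dist_triangle (Phi n 0) _ _) _.
rewrite Phi_sim; have := bM n.
have : r n * eucl_dist 0 (word_map Phi w x) <= r n * M by rewrite ler_pM2l.
by lra.
Qed.

Lemma tiles_setC : ~` T !=set0.
Proof. by have [M HM] := tiles_bounded; exact: bounded_setC_neq0 HM. Qed.

Lemma tiles_finite : (lambda T < +oo)%E.
Proof. by have [M HM] := tiles_bounded; exact: lebesgue_bounded_lt_oo HM. Qed.

Lemma generator_subset : G `<=` T.
Proof. by rewrite tiles_decomposition => x; left. Qed.

Lemma tile_subset n : Phi n @` T `<=` T.
Proof. by move=> x Tx; rewrite tiles_decomposition; right; exists n. Qed.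

Lemma generator_setC : ~` G !=set0.
Proof. by have [y nTy] := tiles_setC; exists y => /generator_subset. Qed.

Lemma tiles_minus_generator : open (T `\` G).
Proof.
have -> : T `\` G = \bigcup_n (Phi n @` T); last first.
  by apply: bigcup_open => n _; exact: tile_open.
apply/seteqP; split=> y; first by move=> [+ nGy]; rewrite {1}tiles_decomposition => -[].
move=> [n _ Ty]; split; first exact: tile_subset Ty.
by move=> Gy; have : set0 y by rewrite -(generator_disjoint n).
Qed.

Lemma tiles_minus_tile n : open (T `\` (Phi n @` T)).
Proof.
have -> : T `\` (Phi n @` T) = G `|` \bigcup_(m in [set m | m != n]) (Phi m @` T).
  apply/seteqP; split=> y.
    move=> [+ nTy]; rewrite {1}tiles_decomposition => -[Gy|[m _ Ty]]; first by left.
    by right; exists m => //; apply/eqP => mn; apply: nTy; rewrite -mn.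
  move=> [Gy|[m mn Ty]]; split; try exact: generator_subset; try exact: tile_subset Ty.
    by move=> Ty; have : set0 y by rewrite -(generator_disjoint n).
  by move=> Ty'; have : set0 y by rewrite -(tiles_disjoint mn).
apply: openU => //; apply: bigcup_open => m _; exact: tile_open.
Qed.

(** The sets [G] and [Phi n @` T] are disjoint and open and have union [T]. By
    locality of the distance to the complement each piece contributes its own
    inner tube, and that of [Phi n @` T] is a scaled copy of a tube of [T]. *)
Lemma inner_tube_tiles e : inner_tube T e =
  (inner_tube G e + \sum_(n < N) (r n ^+ d.+1)%:E * inner_tube T (e / r n))%E.
Proof.
rewrite [LHS](@lebesgue_disjoint_open _ _ N (fun n => Phi n @` T) G) //.
- congr (_ + _)%E.
    by rewrite -[[set x | _]]/(inner_shell T e) inner_shell_clopen //;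
      [exact: tiles_minus_generator|exact: generator_subset|exact: tiles_setC].
  apply: eq_bigr => n _; rewrite -[[set x | _]]/(inner_shell T e).
  rewrite inner_shell_clopen //; first exact: inner_tube_similarity tiles_setC.
  - exact: tile_open.
  - exact: tiles_minus_tile.
  - exact: tile_subset.
  - exact: tiles_setC.
- exact: tile_open.
- exact: generator_disjoint.
- exact: tiles_disjoint.
- by move=> x [Tx _]; rewrite -tiles_decomposition.
Qed.

(** Every tile is a copy of [G] reduced by the ratio of its word, and the distance
    to the complement scales with the copy. *)
Lemma dist_to_tiles x : T x -> dist_to x (~` T) <= g.
Proof.
have [_ _ Gg _] := G_mono; have [g0 _ _] := Gg.
move=> /tilesP[w [x0 [Gx0 ->]]].
suff : dist_to (word_map Phi w x0) (~` T) <= word_ratio r w * g.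
  move=> /le_trans; apply; rewrite ler_piMl ?(ltW g0) // /word_ratio.
  elim: w => [|n w IH]; first by rewrite big_nil.
  rewrite big_cons mulr_ile1 ?(ltW (r_gt0 n)) ?(ltW (r_lt1 n)) //.
  by apply: prodr_ge0 => k _; exact: ltW.
elim: w => [|n w IH] /=.
  rewrite /word_ratio big_nil mul1r.
  rewrite (dist_to_clopen_part G_open tiles_minus_generator generator_subset tiles_setC) //.
  exact: dist_to_le_inradius Gg generator_setC G_open Gx0.
have Tw : T (word_map Phi w x0) by apply/tilesP; exists w, x0.
have sub : Phi n @` T `<=` T by exact: tile_subset.
have oU : open (Phi n @` T) by exact: tile_open.
have oTU : open (T `\` (Phi n @` T)) by exact: tiles_minus_tile.
rewrite (dist_to_clopen_part oU oTU sub tiles_setC);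
  last by exists (word_map Phi w x0).
rewrite -(image_setC (r_gt0 n) (Phi_sim n)) (dist_to_similarity (r_gt0 n) (Phi_sim n)) //;
  last exact: tiles_setC.
by rewrite /word_ratio big_cons -mulrA ler_pM2l.
Qed.

Definition generator_poly : {poly R} :=
  \sum_(k < d.+2 | (k < d.+1)%N) kappa k *: 'X^(d.+1 - k).

Lemma generator_poly0 : generator_poly`_0 = 0.
Proof.
rewrite coef_sum big1 // => k kd; rewrite coefZ coefXn eq_sym subn_eq0.
by rewrite leqNgt kd mulr0.
Qed.

(** The tube volume tends to zero with [e], so that the constant coefficient
    [kappa ord_max] vanishes. *)
Lemma generator_tube e : 0 < e -> inner_tube G e = (generator_poly.[Num.min g e])%:E.
Proof.
move=> e0; have [_ _ Gg Gk] := G_mono; have [g0 _ _] := Gg.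
have hornerE e' : generator_poly.[e'] = \sum_(k < d.+2 | (k < d.+1)%N) kappa k * e' ^+ (d.+1 - k).
  by rewrite horner_sum; apply: eq_bigr => k _; rewrite hornerZ hornerXn.
pose q : {poly R} := \sum_(k < d.+2) kappa k *: 'X^(d.+1 - k).
have qE e' : q.[e'] = \sum_(k < d.+2) kappa k * e' ^+ (d.+1 - k).
  by rewrite horner_sum; apply: eq_bigr => k _; rewrite hornerZ hornerXn.
have qsplit e' : q.[e'] = kappa ord_max + generator_poly.[e'].
  rewrite qE hornerE (bigD1 ord_max) //= subnn expr0 mulr1; congr (_ + _).
  apply: eq_bigl => k; rewrite -val_eqE /= ltn_neqAle andbC.
  by rewrite -ltnS ltn_ord.
have k0 : kappa ord_max = 0.
  have -> : kappa ord_max = q.[0].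
    by rewrite qsplit horner_coef0 generator_poly0 addr0.
  apply: (inner_tube_cvg0 G_open generator_setC _ g0).
    exact: le_lt_trans (lebesgue_le generator_subset) tiles_finite.
  by move=> e' He'; rewrite Gk // qE.
have small e' : 0 < e' <= g -> inner_tube G e' = (generator_poly.[e'])%:E.
  by move=> He'; rewrite Gk // -qE qsplit k0 add0r.
have [ge|eg] := leP g e; last by rewrite small // e0 ltW.
rewrite -(small g) ?g0 ?lexx //.
have full e' : g <= e' -> inner_tube G e' = lambda G.
  move=> ge'; apply: inner_tube_full => x Gx; apply: le_trans ge'.
  exact: dist_to_le_inradius Gg generator_setC G_open Gx.
by rewrite !full.
Qed.

Lemma generator_poly_gt0 : 0 < generator_poly.[g].
Proof.
have [_ _ Gg _] := G_mono; have [g0 _ _] := Gg; have [_ _ G0] := G_single.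
rewrite -lte_fin -[X in _.[X]]minxx -generator_tube // inner_tube_full.
  exact: lebesgue_open_gt0.
move=> x Gx; exact: dist_to_le_inradius Gg generator_setC G_open Gx.
Qed.

Lemma generator_poly_ge0 e : 0 < e <= g -> 0 <= generator_poly.[e].
Proof.
move=> /andP[e0 eg]; rewrite -lee_fin.
by have := generator_tube e0; rewrite (min_r eg) => <-; exact: lebesgue_ge0.
Qed.

Definition tiling_volume e : R := fine (tiling_tube (tiling Phi O) e).

Lemma tiling_volumeE e : tiling_tube (tiling Phi O) e = (tiling_volume e)%:E.
Proof.
rewrite fineK // ge0_fin_numE; last exact: lebesgue_ge0.
by apply: le_lt_trans tiles_finite; apply: lebesgue_le => x [].
Qed.

Lemma tiling_volume_ge0 e : 0 <= tiling_volume e.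
Proof. by rewrite -lee_fin -tiling_volumeE; exact: lebesgue_ge0. Qed.

Lemma tiling_volume_le e e' : e <= e' -> tiling_volume e <= tiling_volume e'.
Proof. by move=> ee'; rewrite -lee_fin -!tiling_volumeE; exact: inner_tube_le. Qed.

Lemma tiling_volume_full e : g <= e -> tiling_volume e = tiling_volume g.
Proof.
move=> ge; apply: EFin_inj; rewrite -!tiling_volumeE.
have full e' : g <= e' -> inner_tube T e' = lambda T.
  move=> ge'; apply: inner_tube_full => x Tx; apply: le_trans ge'.
  exact: dist_to_tiles.
by rewrite /tiling_tube -/T !full.
Qed.

Lemma tiling_volume_renewal e : 0 < e -> tiling_volume e =
  generator_poly.[Num.min g e] + \sum_(n < N) r n ^+ d.+1 * tiling_volume (e / r n).
Proof.
move=> e0; apply: EFin_inj; rewrite -tiling_volumeE /tiling_tube -/T inner_tube_tiles.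
rewrite generator_tube // EFinD -sumEFin; congr (_ + _)%E.
by apply: eq_bigr => n _; rewrite EFinM -tiling_volumeE.
Qed.

End TilingTube.

(** * The abscissa of convergence *)

Section Moran.
Context {R : realType} {N : nat}.
Variable r : 'I_N -> R.
Hypothesis r_itv : forall n, 0 < r n < 1.

Let r_gt0 n : 0 < r n. Proof. by case/andP: (r_itv n). Qed.

Definition moran_sum (s : R) : R := \sum_(n < N) r n `^ s.

Fixpoint words m : seq (seq 'I_N) :=
  if m is m'.+1 then [seq n :: w | n <- enum 'I_N, w <- words m'] else [:: [::]].

Lemma mem_words m w : (w \in words m) = (size w == m).
Proof.
elim: m w => [|m IH] w; first by rewrite inE; case: w.
apply/idP/idP => [/allpairsP[[n w'] /= [_ + ->]]|]; first by rewrite IH.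
case: w => [//|n w]; rewrite /= eqSS => sw; apply/allpairsP; exists (n, w).
by rewrite /= mem_enum IH sw.
Qed.

Lemma words_uniq m : uniq (words m).
Proof.
elim: m => //= m IH; apply: allpairs_uniq => //; first exact: enum_uniq.
by move=> [n w] [n' w'] _ _ /= [-> ->].
Qed.

Lemma sum_words m s :
  \sum_(w <- words m) word_ratio r w `^ s = moran_sum s ^+ m.
Proof.
elim: m => [|m IH].
  by rewrite big_seq1 /word_ratio big_nil powR1.
rewrite big_allpairs_dep /= exprS /moran_sum mulr_suml big_enum /=.
apply: eq_bigr => n _; rewrite -/(moran_sum s) -IH mulr_sumr.
apply: eq_bigr => w _; rewrite /word_ratio big_cons powRM ?ltW //.
by apply: prodr_gt0.
Qed.

Lemma word_ratio_gt0 w : 0 < word_ratio r w.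
Proof. by apply: prodr_gt0. Qed.

Lemma normc_cpow (x s : R) : 0 < x ->
  Normc.normc (cpow x (Complex s 0)) = x `^ s.
Proof.
move=> x0; rewrite /cpow /= mul0r cos0 sin0 mulr1 mulr0 expr0n addr0.
by rewrite sqrtr_sqr ger0_norm ?expR_ge0 // /powR gt_eqF.
Qed.

(** Grouping the words by length turns the series into a geometric one. *)
Lemma scaling_seriesE (s : R) :
  \esum_(w in [set: seq 'I_N])
     (Normc.normc (cpow (word_ratio r w) (Complex s 0)))%:E =
  (\sum_(m <oo) (moran_sum s ^+ m)%:E)%E.
Proof.
pose J m : set (seq 'I_N) := [set` words m].
have -> : [set: seq 'I_N] = \bigcup_m J m.
  apply/seteqP; split=> // w _; exists (size w) => //.
  by have : w \in words (size w) by rewrite mem_words.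
rewrite esum_bigcupT //.
- rewrite -nneseries_esumT; last by move=> m; apply: esum_ge0 => w _; rewrite lee_fin normc_cpow ?word_ratio_gt0 // powR_ge0.
  apply: eq_eseriesr => m _; rewrite esum_fset; last 2 first.
    exact: finite_seq.
    by move=> w _; rewrite lee_fin normc_cpow ?word_ratio_gt0 // powR_ge0.
  rewrite -fsbig_seq ?words_uniq // sumEFin; congr EFin.
  rewrite -sum_words; apply: eq_bigr => w _.
  by rewrite normc_cpow // word_ratio_gt0.
- apply/trivIsetP => i j _ _ ij; apply/seteqP; split=> // w.
  move=> [wi wj]; have {}wi : w \in words i by []; have {}wj : w \in words j by [].
  by move: wi wj ij; rewrite !mem_words => /eqP <- /eqP <-; rewrite eqxx.
- by move=> w; rewrite lee_fin normc_cpow ?word_ratio_gt0 // powR_ge0.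
Qed.

Lemma moran_sum_ge0 s : 0 <= moran_sum s.
Proof. by apply: sumr_ge0 => n _; exact: powR_ge0. Qed.

Lemma scaling_series_convergesP (s : R) :
  scaling_series_converges r (Complex s 0) <-> moran_sum s < 1.
Proof.
rewrite /scaling_series_converges scaling_seriesE; set P := moran_sum s.
have P0 : 0 <= P := moran_sum_ge0 s.
have ge0 m : (0%R <= m)%N -> true -> (0 <= (P ^+ m)%:E)%E.
  by move=> _ _; rewrite lee_fin exprn_ge0.
split=> [fin|P1].
  rewrite ltNge; apply/negP => P1.
  have fS : (\sum_(m <oo) (P ^+ m)%:E)%E \is a fin_num.
    by rewrite ge0_fin_numE //; apply: nneseries_ge0.
  pose S := fine (\sum_(m <oo) (P ^+ m)%:E)%E.
  have := nneseries_lim_ge (Num.truncn S).+1 ge0.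
  rewrite -(fineK fS) -/S sumEFin lee_fin leNgt => /negP; apply.
  apply: lt_le_trans (truncnS_gt S) _.
  rewrite big_mkord -[X in X%:R]card_ord -sumr_const; apply: ler_sum => i _.
  exact: exprn_ege1.
have P1' : 0 < 1 - P by rewrite subr_gt0.
apply: (@le_lt_trans _ _ ((1 - P)^-1)%:E); last exact: ltry.
apply: lime_le; first by apply: is_cvg_nneseries => m *; exact: ge0.
apply: nearW => m; rewrite sumEFin lee_fin -[leRHS]mulr1 ler_pdivlMl // big_mkord.
rewrite -[1 - P]opprB mulNr -subrX1 opprB.
by rewrite gerBl exprn_ge0.
Qed.

(** By [scaling_series_convergesP] the sum is at least one at [D] and less than
    one to the right of [D], and it is continuous. *)
Lemma abscissa_moran D : abscissa_of_convergence r D -> moran_sum D = 1.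
Proof.
move=> hD.
have lt1 s : D < s -> moran_sum s < 1.
  by move=> Ds; apply/scaling_series_convergesP/hD.
have ge1 : 1 <= moran_sum D.
  rewrite leNgt; apply/negP => /scaling_series_convergesP/hD /=.
  by rewrite ltxx.
have cP : continuous moran_sum.
  move=> s; apply: cvg_finite_sum => n.
  suff : continuous (fun s => r n `^ s) by apply.
  have -> : (fun s => r n `^ s) = (fun s => expR (s * ln (r n))).
    by apply/funext => s'; rewrite /powR gt_eqF.
  move=> s'; apply: (@continuous_comp R R R (fun s => s * ln (r n)) expR s').
    by apply: cvgMl; exact: cvg_id.
  exact: continuous_expR.
apply/le_anti; rewrite ge1 andbT.
have cD : moran_sum s @[s --> D^'+] --> moran_sum D.
  by apply: cvg_at_right_filter; exact: cP.
rewrite -(cvg_lim _ cD) //; apply: limr_le; first by apply/cvg_ex; exists (moran_sum D).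
near=> s; apply/ltW/lt1; near: s; exact: nbhs_right_gt.
Unshelve. all: by end_near. Qed.

End Moran.

(** * From logarithmic to linear scale *)

Section LogarithmicScale.
Context {R : realType}.
Implicit Types (f : R -> \bar R) (h : R -> R) (M : \bar R).

Lemma expRN_cvg_at_right : (expR (- t) : R) @[t --> +oo] --> (0 : R)^'+.
Proof.
move=> A [e /= e0 eA]; exists (- ln e); split; first exact: num_real.
move=> t te; apply: eA; last exact: expR_gt0.
rewrite /= sub0r normrN ger0_norm ?expR_ge0 // -[X in _ < X]lnK // ltr_expR.
by rewrite ltrNl.
Qed.

Lemma lnN_cvg_pinfty : (- ln e : R) @[e --> (0 : R)^'+] --> +oo.
Proof.
move=> A [M [_ MA]]; exists (expR (- M)) => /=; first exact: expR_gt0.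
move=> e; rewrite /= sub0r normrN => eM e0; apply: MA.
rewrite ger0_norm ?ltW // in eM.
by rewrite ltrNr -[X in _ < X]expRK ltr_ln ?posrE ?expR_gt0.
Qed.

Lemma cvg_log_scaleP f M :
  f e @[e --> (0 : R)^'+] --> M <-> f (expR (- t)) @[t --> +oo] --> M.
Proof.
split=> [fM|fM]; first exact: cvg_comp expRN_cvg_at_right fM.
have fl := @cvg_comp _ _ _ (fun e : R => - ln e) (fun t => f (expR (- t))) _ _ _
  lnN_cvg_pinfty fM.
apply: cvg_trans fl; apply: near_eq_cvg.
near=> e; rewrite /= opprK lnK // posrE; near: e; exact: nbhs_right_gt.
Unshelve. all: by end_near. Qed.

Lemma cvg_EFinP {T : Type} {F : set_system T} {FF : Filter F} (k : T -> R) (l : R) :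
  k x @[x --> F] --> l <-> (k x)%:E @[x --> F] --> l%:E.
Proof.
split=> [kl|/fine_cvgP[]//]; apply: cvg_EFin => //; exact: nearW.
Qed.

Lemma ln_cvg_pinfty : (ln b : R) @[b --> +oo] --> +oo.
Proof.
move=> A [M [_ MA]]; exists (expR M); split; first exact: num_real.
move=> b Mb; apply: MA; rewrite -[X in X < _]expRK ltr_ln ?posrE ?expR_gt0 //.
exact: lt_trans (expR_gt0 M) Mb.
Qed.

Lemma inv_cvg_pinfty : (t^-1 : R) @[t --> +oo] --> (0 : R).
Proof.
apply/cvg_pinftyP => e e0; exists e^-1 => t et.
have t0 : 0 < t by apply: lt_le_trans et; rewrite invr_gt0.
by rewrite subr0 ger0_norm ?invr_ge0 ?(ltW t0) // invf_ple ?posrE.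
Qed.

Lemma cvg_EFin_real h (T b B : R) M : (forall t, T <= t -> b <= h t <= B) ->
  (h t)%:E @[t --> +oo] --> M -> exists2 m, M = m%:E & h t @[t --> +oo] --> m.
Proof.
move=> hB hM.
have near_ge : \forall t \near +oo, T <= t by apply: nbhs_pinfty_ge; exact: num_real.
have MB : (M <= B%:E)%E.
  rewrite -(cvg_lim _ hM) //; apply: lime_le; first by apply/cvg_ex; exists M.
  by apply: filterS near_ge => t /hB/andP[_]; rewrite lee_fin.
have bM : (b%:E <= M)%E.
  rewrite -(cvg_lim _ hM) //; apply: lime_ge; first by apply/cvg_ex; exists M.
  by apply: filterS near_ge => t /hB/andP[+ _]; rewrite lee_fin.
case: M hM MB bM => [m hm _ _|//|//]; exists m => //.
exact/cvg_EFinP.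
Qed.

End LogarithmicScale.

(** * Minkowski contents of the tiling *)

Section Contents.
Context {R : realType} {d N : nat}.
Local Notation V := 'rV[R]_d.+1.
Variables (r : 'I_N -> R) (Phi : 'I_N -> V -> V).
Hypothesis N_gt0 : (0 < N)%N.
Hypothesis r_itv : forall n, 0 < r n < 1.
Hypothesis Phi_sim : forall n, similarity (r n) (Phi n).
Variables (O G : set V) (g : R) (kappa : 'I_d.+2 -> R).
Hypothesis O_feasible : feasible Phi O.
Hypothesis G_single : single_generator Phi O G.
Hypothesis G_mono : monophase G g kappa.
Variable D : R.
Hypothesis D_moran : moran_sum r D = 1.
Hypothesis D_gt : d%:R < D.
Implicit Types (t e alpha : R).

Local Notation TT := (tiling Phi O).
Local Notation u := (tiling_volume Phi O).
Local Notation q := (generator_poly kappa).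
Let theta : R := d.+1%:R - D.
Let p n : R := r n `^ D.
Let a n : R := - ln (r n).
Let h t : R := expR (theta * t) * u (expR (- t)).

Let r_gt0 n : 0 < r n. Proof. by case/andP: (r_itv n). Qed.
Let r_lt1 n : r n < 1. Proof. by case/andP: (r_itv n). Qed.
Let g_gt0 : 0 < g. Proof. by have [_ _ [g0 _ _] _] := G_mono. Qed.
Let p_gt0 n : 0 < p n. Proof. exact: powR_gt0. Qed.
Let a_gt0 n : 0 < a n. Proof. by rewrite oppr_gt0 ln_lt0 ?r_itv. Qed.
Let q_g : 0 < q.[g].
Proof. exact: (generator_poly_gt0 r_itv Phi_sim G_single G_mono). Qed.

(** The volume balance [V = q(g) + sum_n r_n ^ d * V] at large scales leaves
    room for the generator, so that the sum of the [r_n ^ d] is less than one. *)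
Lemma dimension_lt : D < d.+1%:R.
Proof.
have E := tiling_volume_renewal r_itv Phi_sim O_feasible G_single G_mono g_gt0.
have full n : u (g / r n) = u g.
  apply: (tiling_volume_full r_itv Phi_sim O_feasible G_single G_mono).
  by rewrite ler_pdivlMr // ger_pMr // ltW.
have {}E : u g = q.[g] + (\sum_n r n ^+ d.+1) * u g.
  rewrite {1}E minxx mulr_suml; congr (_ + _).
  by apply: eq_bigr => n _; rewrite full.
have lt1 : moran_sum r d.+1%:R < 1.
  have -> : moran_sum r d.+1%:R = \sum_n r n ^+ d.+1.
    by apply: eq_bigr => n _; rewrite powR_mulrn // ltW.
  rewrite ltNge; apply/negP => ge1.
  have u0 := tiling_volume_ge0 r_itv Phi_sim G_single G_mono g.
  have : 1 * u g <= (\sum_n r n ^+ d.+1) * u g by rewrite ler_wpM2r.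
  by move: q_g E; lra.
rewrite ltNge; apply/negP => dD; move: lt1; rewrite ltNge => /negP; apply.
rewrite -[X in X <= _]D_moran; apply: ler_sum => n _.
by apply: ger_powR dD; rewrite r_gt0 ltW.
Qed.

Let theta_gt0 : 0 < theta. Proof. by rewrite subr_gt0 dimension_lt. Qed.
Let theta_lt1 : theta < 1.
Proof. by rewrite /theta -natr1; move: D_gt; lra. Qed.

Let h_ge0 t : 0 <= h t.
Proof.
rewrite mulr_ge0 ?expR_ge0 //.
exact: (tiling_volume_ge0 r_itv Phi_sim G_single G_mono).
Qed.

Let h_growth t s : 0 <= s -> h (t + s) <= expR (theta * s) * h t.
Proof.
move=> s0; rewrite /h mulrDr expRD [_ * expR (theta * s)]mulrC -mulrA.
apply: ler_wpM2l; first exact: expR_ge0.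
apply: ler_wpM2l; first exact: expR_ge0.
apply: (tiling_volume_le r_itv Phi_sim G_single G_mono).
by rewrite ler_expR; lra.
Qed.

Let h_left t : t <= - ln g -> h t = u g * expR (theta * t).
Proof.
move=> tg; rewrite /h mulrC; congr (_ * _).
apply: (tiling_volume_full r_itv Phi_sim O_feasible G_single G_mono).
by rewrite -[X in X <= _]lnK // ler_expR lerNr.
Qed.

Let h_renewal t : h t = expR (theta * t) * q.[Num.min g (expR (- t))] +
  \sum_n p n * h (t - a n).
Proof.
rewrite /h (tiling_volume_renewal r_itv Phi_sim O_feasible G_single G_mono) ?expR_gt0 //.
rewrite mulrDr mulr_sumr; congr (_ + _); apply: eq_bigr => n _.
rewrite /p /a /powR gt_eqF // opprK.
have -> : expR (- (t + ln (r n))) = expR (- t) / r n.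
  by rewrite opprD expRD [expR (- ln _)]expRN lnK ?posrE.
rewrite !mulrA -expRD; congr (_ * _).
rewrite -{1}(lnK (_ : r n \is Num.pos)) ?posrE // -expRM_natl -expRD; congr expR.
by rewrite /theta; ring.
Qed.

Let mu : R := \sum_n p n * a n.
Let A : R := tube_moment theta g q.

Let q_ge0 x : 0 < x <= g -> 0 <= q.[x].
Proof. exact: (generator_poly_ge0 r_itv Phi_sim G_single G_mono). Qed.

Let A_gt0 : 0 < A.
Proof.
exact: (tube_moment_gt0 a_gt0 theta_gt0 theta_lt1 g_gt0
  (generator_poly0 kappa) q_ge0 q_g h_left h_renewal).
Qed.

Let mu_gt0 : 0 < mu. Proof. exact: mean_step_gt0. Qed.

Lemma content_value_gt0 : 0 < A / theta / mu.
Proof. by apply: divr_gt0; [apply: divr_gt0|]. Qed.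

Lemma Gamma_coefE : Gamma_coef g kappa D = A.
Proof.
rewrite /A /tube_moment; set F := fun j : nat => j%:R * g `^ (j%:R - theta) / (j%:R - theta).
have sq : (size q <= d.+2)%N.
  apply: leq_trans (size_sum _ _ _) _; apply/bigmax_leqP => k _.
  apply: leq_trans (size_scale_leq _ _) _; rewrite size_polyXn ltnS.
  by apply: leq_trans (leq_subr _ _) _.
transitivity (\sum_(j < d.+2) q`_j * F j); last first.
  rewrite (big_ord_widen _ (fun j => q`_j * F j) sq) [LHS](bigID (fun j : 'I__ => (j < size q)%N)) /=.
  rewrite [X in _ + X]big1 ?addr0 // => j; rewrite -leqNgt => sj.
  by rewrite nth_default // mul0r.
under [RHS]eq_bigr => j _.
  rewrite coef_sum mulr_suml.
  under eq_bigr => k _ do rewrite coefZ coefXn.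
  over.
rewrite exchange_big; apply: eq_bigr => k kd.
have kd' : (d.+1 - k < d.+2)%N by rewrite ltnS leq_subr.
rewrite (bigD1 (Ordinal kd')) //= eqxx mulr1 big1 ?addr0; last first.
  by move=> j /negbTE; rewrite -val_eqE /= => ->; rewrite mulr0 mul0r.
rewrite /F; have -> : (d.+1 - k)%:R - theta = D - k%:R.
  by rewrite natrB ?(ltnW kd) // /theta; ring.
by field; rewrite subr_eq0 gt_eqF // (le_lt_trans _ D_gt) // ler_nat -ltnS.
Qed.

(** In logarithmic scale the exponent [alpha] only contributes an exponential
    factor to [h], growing below [D] and decaying above. *)
Lemma contentP alpha M : minkowski_content TT alpha M <->
  (expR ((D - alpha) * t) * h t)%:E @[t --> +oo] --> M.
Proof.
have E t : ((expR (- t) `^ (- (d.+1%:R - alpha)))%:E *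
    tiling_tube TT (expR (- t)))%E = (expR ((D - alpha) * t) * h t)%:E.
  rewrite (tiling_volumeE r_itv Phi_sim G_single G_mono) -EFinM; congr EFin.
  rewrite /h mulrA -expRD; congr (_ * _).
  by rewrite /powR gt_eqF ?expR_gt0 // expRK; congr expR; rewrite /theta; ring.
split=> [/cvg_log_scaleP H|H]; last apply/cvg_log_scaleP.
  by apply: cvg_trans H; apply: near_eq_cvg; apply: nearW => t /=; rewrite E.
by apply: cvg_trans H; apply: near_eq_cvg; apply: nearW => t /=; rewrite E.
Qed.

Lemma contentDP M : minkowski_content TT D M <-> (h t)%:E @[t --> +oo] --> M.
Proof.
rewrite contentP; under eq_fun do rewrite subrr mul0r expR0 mul1r.
by [].
Qed.

Let h_bounded T0 : exists B, forall t, T0 <= t -> h t <= B.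
Proof.
exact: (log_tube_bounded N_gt0 p_gt0 D_moran a_gt0 theta_gt0 theta_lt1 g_gt0
  (generator_poly0 kappa) h_ge0 h_growth h_left h_renewal).
Qed.

Lemma lattice_steps rho k : lattice_with r rho k ->
  0 < - ln rho /\ forall n, (0 < k n)%N /\ a n = (k n)%:R * - ln rho.
Proof.
move=> [/andP[rho0 rho1] Hk]; split; first by rewrite oppr_gt0 ln_lt0 ?rho0.
move=> n; have [kn rn] := Hk n; split=> //.
by rewrite /a rn lnXn // mulrN mulr_natl.
Qed.

Lemma nonlattice_steps : ~ lattice r ->
  ~ (exists2 l : R, 0 < l &
     exists k : 'I_N -> nat, forall n, (0 < k n)%N /\ a n = (k n)%:R * l).
Proof.
move=> nl [l l0 [k Hk]]; apply: nl; exists (expR (- l)), k; split.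
  by rewrite expR_gt0 -expR0 ltr_expR oppr_lt0.
move=> n; have [kn an] := Hk n; split=> //.
by rewrite -expRM_natl mulrN -an /a opprK lnK ?posrE.
Qed.

Lemma content_nonlattice : ~ lattice r ->
  minkowski_content TT D (A / theta / mu)%:E.
Proof.
move=> /nonlattice_steps nl; apply/contentDP/cvg_EFinP.
exact: (log_tube_cvg_nonlattice N_gt0 p_gt0 D_moran a_gt0 theta_gt0 theta_lt1 g_gt0
  (generator_poly0 kappa) h_ge0 h_growth h_left h_renewal nl).
Qed.

(** A limit in the extended reals would be finite, since [h] is bounded. *)
Lemma no_content_lattice M : lattice r -> ~ minkowski_content TT D M.
Proof.
move=> [rho [k lat]] /contentDP hM.
have [B HB] := h_bounded 0.
have [m _ hm] : exists2 m, M = m%:E & h t @[t --> +oo] --> m.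
  by apply: (@cvg_EFin_real _ h 0 0 B M _ hM) => t t0; rewrite h_ge0 HB.
have [l0 Hl] := lattice_steps lat.
exact: (log_tube_not_cvg_lattice N_gt0 p_gt0 D_moran theta_gt0 theta_lt1 g_gt0
  (generator_poly0 kappa) q_g h_ge0 h_left h_renewal l0 (fun n => (Hl n).1) (fun n => (Hl n).2) hm).
Qed.

Lemma content0_above alpha : D < alpha -> minkowski_content TT alpha 0%E.
Proof.
move=> Da; apply/contentP/cvg_EFinP.
have [B0 HB0] := h_bounded 0; pose B := `|B0|.
have HB t : 0 <= t -> h t <= B.
  by move=> /HB0 /le_trans; apply; exact: ler_norm.
apply: (@squeeze_cvgr _ _ _ _ (fun=> 0) (fun t => B * expR (- ((alpha - D) * t)))).
- exists 0; split; first exact: num_real.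
  move=> t /ltW t0; rewrite mulr_ge0 ?expR_ge0 //= mulrC.
  have -> : (D - alpha) * t = - ((alpha - D) * t) by ring.
  by rewrite ler_wpM2r ?expR_ge0 // HB.
- exact: cvg_cst.
- rewrite -[X in _ --> X](mulr0 B); apply: cvgMr.
  by apply: cvg_expR_decay => //; rewrite subr_gt0.
Qed.

Lemma h_not_cvg0 : ~ (h t @[t --> +oo] --> (0 : R)).
Proof.
move=> h0; have c0 : minkowski_content TT D 0%E.
  by apply/contentDP/cvg_EFinP.
have [lat|nl] := pselect (lattice r); first exact: no_content_lattice lat c0.
have := content_nonlattice nl; move/contentDP/cvg_EFinP => hc.
have E : A / theta / mu = 0 by exact: (cvg_unique (@norm_hausdorff _ _) hc h0).
have := content_value_gt0.
by rewrite E ltxx.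
Qed.

Lemma no_finite_content_below alpha (m : R) : alpha < D ->
  ~ minkowski_content TT alpha m%:E.
Proof.
move=> aD /contentP/cvg_EFinP hm; apply: h_not_cvg0.
have -> : h = (fun t => expR (- ((D - alpha) * t)) *
    (expR ((D - alpha) * t) * h t)).
  by apply/funext => t; rewrite mulrA -expRD addNr expR0 mul1r.
rewrite -[X in _ --> X](mul0r m); apply: cvgM; last exact: hm.
by apply: cvg_expR_decay => //; rewrite subr_gt0.
Qed.

Lemma content0P alpha : minkowski_content TT alpha 0%E <-> D < alpha.
Proof.
split; last exact: content0_above.
move=> c0; rewrite ltNge; apply/negP; rewrite le_eqVlt => /orP[/eqP aD|aD].
  apply: h_not_cvg0; rewrite aD in c0.
  exact/cvg_EFinP/contentDP.
exact: no_finite_content_below aD c0.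
Qed.

Lemma minkowski_dimE : minkowski_dim TT = D.
Proof.
have dD := dimension_lt; have D0 : 0 < D by apply: le_lt_trans D_gt.
have E : [set alpha | 0 <= alpha <= d.+1%:R /\ minkowski_content TT alpha 0%E] =
    [set alpha | D < alpha <= d.+1%:R].
  apply/seteqP; split=> x /=.
    by move=> [/andP[x0 ->] /content0P ->].
  move=> /andP[Dx xd]; split; last exact/content0P.
  by rewrite xd andbT ltW // (lt_trans D0).
rewrite /minkowski_dim E; apply/le_anti/andP; split.
  apply/ler_addgt0Pr => e e0.
  apply: (@le_trans _ _ (Num.min (D + e) d.+1%:R)); last by rewrite ge_min lexx.
  apply: ge_inf; first by exists D => x /= /andP[/ltW].
  by rewrite /= lt_min ltrDl e0 dD /= ge_min lexx orbT.
apply: lb_le_inf; first by exists d.+1%:R; rewrite /= dD lexx.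
by move=> x /= /andP[/ltW].
Qed.

Lemma measurable_iff_nonlattice : minkowski_measurable TT <-> ~ lattice r.
Proof.
have dD := dimension_lt; have D0 : 0 < D by apply: le_lt_trans D_gt.
split=> [[alpha [_ [M [cM /andP[M0 Moo]]]]] lat|nl].
  have [aD|Da|aD] := ltgtP alpha D.
  - case: M cM M0 Moo => [m cM _ _|//|//]; exact: no_finite_content_below aD cM.
  - have := content0_above Da; move: cM; rewrite /minkowski_content => cM c0.
    have E : M = 0%E by exact: (cvg_unique (@ereal_hausdorff _) cM c0).
    by rewrite E ltxx in M0.
  - by rewrite aD in cM; exact: no_content_lattice lat cM.
exists D; split; first by rewrite ltW //= ltW.
exists (A / theta / mu)%:E; split; first exact: content_nonlattice.
by rewrite ltry andbT lte_fin; exact: content_value_gt0.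
Qed.

(** The substitution [e = expR (- t)] turns the integral into the increment of a
    primitive of [h] from [0] to [ln b]. *)
Lemma average_content : average_minkowski_content TT D (A / theta / mu)%:E.
Proof.
have [H dH HA] := log_tube_average N_gt0 p_gt0 D_moran a_gt0 theta_gt0 theta_lt1 g_gt0
  (generator_poly0 kappa) h_ge0 h_growth h_left h_renewal.
have ch : continuous h.
  exact: (h_continuous a_gt0 h_left h_renewal).
have int_eq b : 1 < b -> (\int[lebesgue_measure]_(e in `[b^-1%R, 1%R])
     ((e `^ (- (d.+1%:R - D)))%:E * tiling_tube TT e * (e^-1)%R%:E) =
     (H (ln b) - H 0)%:E)%E.
  move=> b1; have b0 : 0 < b by apply: lt_trans b1.
  have bV : 0 < b^-1 by rewrite invr_gt0.
  pose f e := h (- ln e) / e; pose F e := - H (- ln e).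
  transitivity (\int[lebesgue_measure]_(e in `[b^-1%R, 1%R]) (f e)%:E)%E.
    apply: eq_integral => e; rewrite inE /= in_itv /= => /andP[be _].
    have e0 : 0 < e by apply: lt_le_trans be.
    rewrite (tiling_volumeE r_itv Phi_sim G_single G_mono) -!EFinM; congr EFin.
    by rewrite /f /h opprK lnK // /powR gt_eqF // mulrN -mulNr.
  have dF e : 0 < e -> is_derive e 1 F (f e).
    move=> e0; rewrite /f -[h _ / e]opprK -mulrN.
    have dln : is_derive e 1 (fun x => - ln x : R) (- e^-1).
      by apply: is_deriveN; exact: is_derive1_ln.
    have d1 := @is_derive1_comp _ H (fun e => - ln e) e _ _ (dH _) dln.
    exact: (is_deriveN d1).
  have cF e : 0 < e -> {for e, continuous F}.
    move=> e0; apply/differentiable_continuous; rewrite -derivable1_diffP.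
    by have [] := dF e e0.
  rewrite (@continuous_FTC2 _ f F).
  - by rewrite /F ln1 oppr0 lnV ?posrE // opprK -EFinB; congr EFin; ring.
  - by rewrite invf_lt1.
  - apply/continuous_in_subspaceT => e; rewrite inE /= in_itv /= => /andP[be _].
    have e0 : 0 < e by apply: lt_le_trans be.
    apply: cvgM; last by apply: cvgV; [rewrite gt_eqF|exact: cvg_id].
    apply: (@continuous_comp R R R (fun e => - ln e) h e); last exact: ch.
    by apply: cvgN; exact: continuous_ln.
  - split.
    + move=> e; rewrite in_itv /= => /andP[be _].
      by have [] := dF e (lt_trans bV be).
    + by apply: cvg_at_right_filter; exact: cF.
    + by apply: cvg_at_left_filter; exact: cF.
  - move=> e; rewrite in_itv /= => /andP[be _].
    have [_ <-] := dF e (lt_trans bV be).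
    by rewrite derive1E.
have lim : (ln b)^-1 * (H (ln b) - H 0) @[b --> +oo] --> A / theta / mu.
  have : H t / t - H 0 * t^-1 @[t --> +oo] --> A / theta / mu - H 0 * 0.
    by apply: cvgB; [exact: HA|apply: cvgMr; exact: inv_cvg_pinfty].
  rewrite mulr0 subr0 => lim.
  have lim' := @cvg_comp _ _ _ (fun b : R => ln b) (fun t => H t / t - H 0 * t^-1)
    _ _ _ ln_cvg_pinfty lim.
  apply: cvg_trans lim'; apply: near_eq_cvg.
  by apply: nearW => b /=; ring.
have : ((ln b)^-1 * (H (ln b) - H 0))%:E @[b --> +oo] --> (A / theta / mu)%:E.
  exact/cvg_EFinP.
apply: cvg_trans; apply: near_eq_cvg; exists 1; split; first exact: num_real.
by move=> b b1; rewrite int_eq.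
Qed.

Lemma content_valueE : Gamma_coef g kappa D /
  ((d.+1%:R - D) * \sum_(n < N) r n `^ D * ln (r n)^-1) = A / theta / mu.
Proof.
rewrite Gamma_coefE -/theta invfM mulrA; congr (_ / _).
by apply: eq_bigr => n _; rewrite lnV ?posrE.
Qed.

Lemma content_value_latticeE rho k : lattice_with r rho k ->
  Gamma_coef g kappa D / ((d.+1%:R - D) *
    \sum_(n < N) rho `^ ((k n)%:R * D) * (k n)%:R * ln rho^-1) = A / theta / mu.
Proof.
move=> lat; have [_ Hl] := lattice_steps lat; case: lat => /andP[rho0 _] Hk.
rewrite Gamma_coefE -/theta invfM mulrA; congr (_ / _).
apply: eq_bigr => n _; rewrite (Hl n).2 lnV ?posrE // /p (Hk n).2.
by rewrite powRrM powR_mulrn ?ltW // mulrA.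
Qed.

End Contents.

(** * Minkowski measurability of the tiling *)

Theorem theorem4p8 (R : realType) (d N : nat) (hd : (0 < d)%N) (hN : (2 <= N)%N)
  (r : 'I_N -> R) (Phi : 'I_N -> 'rV[R]_d -> 'rV[R]_d)
  (hr : forall n, 0 < r n < 1)
  (hPhi : forall n, similarity (r n) (Phi n))
  (hOSC : open_set_condition Phi)
  (F : set 'rV[R]_d) (hF : nontrivial_attractor Phi F)
  (O : set 'rV[R]_d) (hO : feasible Phi O)
  (G : set 'rV[R]_d) (hG : single_generator Phi O G)
  (g : R) (kappa : 'I_d.+1 -> R) (hmono : monophase G g kappa)
  (D : R) (hD : abscissa_of_convergence r D) (hdD : d%:R - 1 < D) :
  let c : R := Gamma_coef g kappa D /
    ((d%:R - D) * \sum_(n < N) r n `^ D * ln (r n)^-1) in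
  [/\ minkowski_dim (tiling Phi O) = D,
      (minkowski_measurable (tiling Phi O) <-> ~ lattice r) /\
      (~ lattice r ->
         minkowski_content (tiling Phi O) D c%:E /\ (0 < c%:E < +oo)%E) &
      forall (rho : R) (k : 'I_N -> nat), lattice_with r rho k ->
        let c' : R := Gamma_coef g kappa D /
          ((d%:R - D) *
           \sum_(n < N) rho `^ ((k n)%:R * D) * (k n)%:R * ln rho^-1) in
        [/\ ~ (exists M, minkowski_content (tiling Phi O) D M),
            average_minkowski_content (tiling Phi O) D c'%:E &
            (0 < c'%:E < +oo)%E]].
Proof.
case: d hd Phi hPhi hOSC F hF O hO G hG kappa hmono hdD => [//|m] _
  Phi hPhi _ F _ O hO G hG kappa hmono hdD.
have N0 : (0 < N)%N by apply: leq_trans hN.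
have Dm := abscissa_moran hr hD.
have Dgt : m%:R < D by move: hdD; rewrite -natr1 addrK.
have val := content_valueE hr g kappa Dgt.
have val0 := content_value_gt0 N0 hr hPhi hO hG hmono Dm Dgt.
move=> c; split.
- exact: (minkowski_dimE N0 hr hPhi hO hG hmono Dm Dgt).
- split; first exact: (measurable_iff_nonlattice N0 hr hPhi hO hG hmono Dm Dgt).
  move=> nl; rewrite /c val ltry andbT lte_fin; split; last exact: val0.
  exact: (content_nonlattice N0 hr hPhi hO hG hmono Dm Dgt nl).
- move=> rho k lat c'; rewrite /c' (content_value_latticeE g kappa Dgt lat).
  split; last by rewrite ltry andbT lte_fin; exact: val0.
  + move=> [M]; apply: (no_content_lattice N0 hr hPhi hO hG hmono Dm Dgt).
    by exists rho, k.
  + exact: (average_content N0 hr hPhi hO hG hmono Dm Dgt).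
Qed.
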